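(* Let $\mathcal{U}\subset\mathbb{C}^n$ be a connected open set and let $(a_1X,a_2X,\dots,a_pX)$ be a rigid $p$-chambar on $\mathcal{U}$, where $X$ is a holomorphic vector field on $\mathcal{U}$ and the $a_i$ are complex constants. If $X$ has a singular point, then the singular set $\mathrm{Sing}(X)$ of $X$ has dimension $\geq 1$.
   Context: For a holomorphic vector field $X$ on an open set $\mathcal{U}\subset\mathbb{C}^n$, $\exp(tX)$ denotes its local flow. A $p$-chambar on $\mathcal{U}$ is a $p$-tuple of pairwise distinct, not identically zero holomorphic vector fields $X_1,\dots,X_p$ on $\mathcal{U}$ satisfying the barycentric property: $\sum_{k=1}^p X_k(\exp(tX_k)(x))=0$ for all $x\in\mathcal{U}$ and all small $t\in\mathbb{C}$; equivalently $\sum_{k=1}^p\exp(tX_k)(x)=p\,x$. A $p$-chambar is rigid if it has the form $(a_1X,\dots,a_pX)$ with $X$ a vector field and the $a_i$ constants. A singular point of $X$ is a point $m\in\mathcal U$ with $X(m)=0$, and $\mathrm{Sing}(X)=\{m\in\mathcal{U}: X(m)=0\}$, whose dimension is its dimension as a complex analytic set. *)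

(* Defs.v *)
From HB Require Import structures.
From mathcomp Require Import all_boot all_order all_algebra.
From mathcomp Require Import all_classical all_reals all_analysis.
From mathcomp Require Import complex.

Set Implicit Arguments.
Unset Strict Implicit.
Unset Printing Implicit Defensive.

Import Order.TTheory GRing.Theory Num.Theory.
Import numFieldNormedType.Exports.

Local Open Scope classical_set_scope.
Local Open Scope ring_scope.

(* The alias ^o is what carries the normed-module (hence topological)
   structure of the complex field over itself. *)
Notation Cplx R := (R[i]^o).
Notation Cspace R n := 'rV[Cplx R]_n.

(* Only the values on U matter. The scalar field of all the normed modules is
   the complex field, so [differentiable] is complex Frechet
   differentiability. *)
Definition holomorphic_on (R : realType) (V W : normedModType (Cplx R))
    (U : set V) (f : V -> W) : Prop :=
  forall x, U x -> differentiable f x.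

(* phi is t |-> exp(tX)(x), as a germ at t = 0 of a function of the complex
   time t: phi' is a complex derivative, and phi stays in U, where X lives.
   Such a germ exists and is unique when X is holomorphic on the open set U
   and x is in U (Cauchy's theorem for holomorphic differential equations). *)
Definition is_flow_at (R : realType) (n : nat) (U : set (Cspace R n))
    (X : Cspace R n -> Cspace R n) (x : Cspace R n)
    (phi : Cplx R -> Cspace R n) : Prop :=
  phi 0 = x /\
  \forall t \near (0 : Cplx R), U (phi t) /\ is_derive t 1 phi (X (phi t)).

(* "Pairwise distinct" and "not identically zero" are taken as vector fields
   on U. How small t must be is allowed to depend on the point x. *)
Definition is_chambar (R : realType) (n p : nat) (U : set (Cspace R n))
    (X : 'I_p -> Cspace R n -> Cspace R n) : Prop :=
  [/\ (0 < p)%N,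
      forall k, holomorphic_on U (X k),
      forall k, exists2 x, U x & X k x <> 0,
      forall j k, j != k -> exists2 x, U x & X j x <> X k x &
      forall x, U x -> exists phi : 'I_p -> Cplx R -> Cspace R n,
        (forall k, is_flow_at U (X k) x (phi k)) /\
        \forall t \near (0 : Cplx R), \sum_(k < p) X k (phi k t) = 0].

Definition Sing (R : realType) (n : nat) (U : set (Cspace R n))
    (X : Cspace R n -> Cspace R n) : set (Cspace R n) :=
  [set m | U m /\ X m = 0].

(* There are d germs f_j of holomorphic functions vanishing at a such that a
   is an isolated point of A `&` {f_1 = ... = f_d = 0}. *)
Definition isolating (R : realType) (n : nat) (A : set (Cspace R n))
    (a : Cspace R n) (d : nat) : Prop :=
  exists f : 'I_d -> Cspace R n -> Cplx R,
    [/\ forall j, f j a = 0,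
        forall j, \forall z \near a, differentiable (f j) z &
        \forall z \near a, A z -> (forall j, f j z = 0) -> z = a].

(* Dimension of the complex analytic set A at its point a, following Grauert
   and Remmert (Coherent Analytic Sheaves, Ch. 5): the least number of
   holomorphic germs at a that isolate a in A. The n coordinate functions
   z_i - a_i do so, hence this is an infimum over a nonempty set of natural
   numbers, attained, and at most n. *)
Definition analytic_dim_at (R : realType) (n : nat) (A : set (Cspace R n))
    (a : Cspace R n) : \bar R :=
  ereal_inf [set (d%:R)%:E | d in isolating A a].

(* The empty set has dimension -oo. *)
Definition analytic_dim (R : realType) (n : nat) (A : set (Cspace R n)) :
    \bar R :=
  ereal_sup [set analytic_dim_at A a | a in A].

(* Main.v *)
(* Near a point of U every trajectory of X is a polynomial in the time t, of degree
   bounded in terms of p: along a trajectory phi the barycentric property gives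
   sum_k a_k (X o phi)(u + a_k t) = 0 with nonzero, pairwise distinct a_k, and
   eliminating the terms one by one shows that X o phi is a polynomial.

   Suppose that m is an isolated zero of X. A trajectory starting at x <> m near m
   is a nonconstant polynomial in t, so it leaves a small ball around m, say at
   time T. By a Markov inequality its speed at the exit point is at most C / T,
   while |X| is bounded below on the sphere; hence T stays bounded as x tends
   to m. But X is Lipschitz and vanishes at m, so the exit time tends to infinity,
   a contradiction.

   The analytic input (Lipschitz bounds for X, uniqueness of flows and analytic
   continuation of the trajectories) rests on the maximum principle for functions
   that are merely complex differentiable. *)

Require Import Defs.
From HB Require Import structures.
From mathcomp Require Import all_boot all_order all_algebra.
From mathcomp Require Import all_classical all_reals all_analysis.
From mathcomp Require Import complex.
From mathcomp Require Import ring lra.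
Import Order.TTheory GRing.Theory Num.Theory.
Import numFieldNormedType.Exports.
Local Open Scope classical_set_scope.
Local Open Scope ring_scope.

Set Implicit Arguments.
Unset Strict Implicit.

(** [differentiable] gives a complex derivative at each point and nothing else: neither continuity
    of that derivative, nor power series, nor Cauchy's formula. Two consequences of the maximum
    principle stand in for them: a Schwarz lemma, which turns a bound on [X] into a Lipschitz bound,
    and an identity theorem on discs. The maximum principle is proved for twice differentiable
    functions and carried over to all others through primitives.

    The degree bound matters as much as polynomiality: it makes the Markov constant [C] independent
    of the trajectory, so [C] is fixed before the starting point [x]. Hence no limit is taken: the
    exit time is at most C * eps / c, the distance to [m] at most doubles in a time 1 / (2 L), and
    [x] is placed so close to [m] that the doublings available do not reach the sphere.

    Dimension enters only through the value 0: dimension 0 at [m] means that the empty family of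
    germs isolates [m] in [Sing U X], so that [m] is an isolated zero. *)

(** * Complex derivatives with a real modulus *)

(* The norm of [R[i]] takes its values in [R[i]]; [cmod] is the same modulus with
   values in the ordered field [R]. *)
Definition cmod (R : realType) (z : R[i]) : R := Normc.normc z.

(** Multiplied out rather than a limit of quotients: w = z is no exception, and estimates stay
    linear in real quantities. [cderivP] identifies it with [is_derive]. *)
Definition cderiv (R : realType) (g : R[i] -> R[i]) (z d : R[i]) : Prop :=
  forall e : R, 0 < e -> exists2 r : R, 0 < r &
    forall w, cmod (w - z) < r ->
      cmod (g w - g z - d * (w - z)) <= e * cmod (w - z).

Lemma normCE (R : realType) (z : R[i]) : `|z| = (cmod z)%:C%C.
Proof. by []. Qed.

Lemma cmod_ge0 (R : realType) (z : R[i]) : 0 <= cmod z.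
Proof. by rewrite -ler0c -normCE. Qed.

Lemma cmod0 (R : realType) : @cmod R 0 = 0.
Proof. exact: Normc.normc0. Qed.

Lemma cmod_eq0 (R : realType) (z : R[i]) : cmod z = 0 -> z = 0.
Proof. exact: Normc.eq0_normc. Qed.

Lemma cmod_gt0 (R : realType) (z : R[i]) : z != 0 -> 0 < cmod z.
Proof.
by move=> z0; rewrite lt_def cmod_ge0 andbT; apply: contra_neq z0 => /cmod_eq0.
Qed.

Lemma cmodM (R : realType) (z w : R[i]) : cmod (z * w) = cmod z * cmod w.
Proof. exact: Normc.normcM. Qed.

Lemma cmodV (R : realType) (z : R[i]) : cmod z^-1 = (cmod z)^-1.
Proof. exact: Normc.normcV. Qed.

Lemma cmodN (R : realType) (z : R[i]) : cmod (- z) = cmod z.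
Proof. exact: normcN. Qed.

Lemma cmodX (R : realType) (z : R[i]) n : cmod (z ^+ n) = cmod z ^+ n.
Proof. by apply: complexI; rewrite rmorphXn /= -!normCE normrX. Qed.

Lemma cmod_le_add (R : realType) (z w : R[i]) : cmod (z + w) <= cmod z + cmod w.
Proof. exact: le_normcD. Qed.

Lemma cmod_distC (R : realType) (z w : R[i]) : cmod (z - w) = cmod (w - z).
Proof. by rewrite -cmodN opprB. Qed.

Lemma cmod_le_sum (R : realType) (I : Type) (s : seq I) (P : pred I) (F : I -> R[i]) :
  cmod (\sum_(i <- s | P i) F i) <= \sum_(i <- s | P i) cmod (F i).
Proof.
elim/big_ind2 : _ => [|x a y b xa yb|//]; first by rewrite cmod0.
exact: le_trans (cmod_le_add _ _) (lerD xa yb).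
Qed.

Lemma cmod_real (R : realType) (x : R) : cmod x%:C%C = `|x|.
Proof. by rewrite /cmod /Normc.normc /= expr0n addr0 sqrtr_sqr. Qed.

Lemma near_cmodP (R : realType) (z : Cplx R) (P : Cplx R -> Prop) :
  (\forall w \near z, P w) <->
  exists2 r : R, 0 < r & forall w : R[i], cmod (w - z) < r -> P w.
Proof.
split=> [/nbhs_ballP[e /= e0 eP]|[r r0 rP]].
  have eE : e = (complex.Re e)%:C%C by rewrite RRe_real// gtr0_real.
  exists (complex.Re e); first by rewrite -ltcR -eE.
  move=> w we; apply: eP; rewrite -ball_normE /= distrC normCE eE ltcR//.
apply/nbhs_ballP; exists r%:C%C => /=; first by rewrite ltcR.
move=> w; rewrite -ball_normE /= distrC normCE ltcR; exact: rP.
Qed.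

Lemma cderivP (R : realType) (g : Cplx R -> Cplx R) (z d : Cplx R) :
  cderiv g z d <-> is_derive z (1 : Cplx R) g d.
Proof.
have key : cderiv g z d <->
    (fun h : Cplx R => h^-1 *: (g (h *: 1 + z) - g z)) @ 0^' --> d.
  split=> [gz|/cvgrPdist_le gz].
    apply/cvgrPdist_le => e e0.
    have eE : e = (complex.Re e)%:C%C by rewrite RRe_real// gtr0_real.
    have Re0 : 0 < complex.Re e by rewrite -ltcR -eE.
    have [r r0 rP] := gz _ Re0.
    rewrite near_withinE; apply/near_cmodP; exists r => // h; rewrite subr0.
    move=> hr h0; have := rP (h + z); rewrite addrK => /(_ hr) le1.
    rewrite distrC normCE eE lecR.
    have -> : h^-1 *: (g (h *: (1 : Cplx R) + z) - g z) - d =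
       h^-1 * (g (h + z) - g z - d * h).
      by rewrite /GRing.scale/= mulr1; field.
    rewrite cmodM cmodV ler_pdivrMl//; first by rewrite [leRHS]mulrC.
    by rewrite lt_def cmod_ge0 andbT; apply: contra_neq h0 => /cmod_eq0.
  move=> e e0; have e0' : 0 < (e%:C%C : R[i]) by rewrite ltcR.
  have := gz _ e0'; rewrite near_withinE => /near_cmodP[r r0 rP].
  exists r => // w wr; have [->|wz] := eqVneq w z.
    by rewrite !subrr mulr0 subrr cmod0 mulr0.
  have := rP (w - z); rewrite subr0 => /(_ wr); rewrite subr_eq0 => /(_ wz).
  have -> : d - (w - z)^-1 *: (g ((w - z) *: (1 : Cplx R) + z) - g z) =
       - ((w - z)^-1 * (g w - g z - d * (w - z))).
    by rewrite /GRing.scale/= mulr1 subrK; field; rewrite ?subr_eq0.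
  rewrite normCE cmodN lecR cmodM cmodV ler_pdivrMl//; first by rewrite [leRHS]mulrC.
  rewrite lt_def cmod_ge0 andbT -[0]/(0 : R); move: wz; rewrite -subr_eq0.
  by apply: contra_neq => /cmod_eq0.
rewrite key; split=> [c|[/= dg <-]]; last exact: dg.
by split; [apply/cvg_ex; exists d|exact/cvg_lim].
Qed.

Lemma cderiv_cst (R : realType) (c z : R[i]) : cderiv (fun=> c) z 0.
Proof. by apply/cderivP; exact: is_derive_cst. Qed.

Lemma cderiv_id (R : realType) (z : R[i]) : cderiv (fun w => w) z 1.
Proof. by apply/cderivP; exact: is_derive_id. Qed.

Lemma cderivD (R : realType) (f g : R[i] -> R[i]) z df dg :
  cderiv f z df -> cderiv g z dg -> cderiv (fun w => f w + g w) z (df + dg).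
Proof. by move=> /cderivP hf /cderivP hg; apply/cderivP; exact: is_deriveD. Qed.

Lemma cderivB (R : realType) (f g : R[i] -> R[i]) z df dg :
  cderiv f z df -> cderiv g z dg -> cderiv (fun w => f w - g w) z (df - dg).
Proof. by move=> /cderivP hf /cderivP hg; apply/cderivP; exact: is_deriveB. Qed.

Lemma cderivM (R : realType) (f g : R[i] -> R[i]) z df dg :
  cderiv f z df -> cderiv g z dg ->
  cderiv (fun w => f w * g w) z (f z * dg + g z * df).
Proof. by move=> /cderivP hf /cderivP hg; apply/cderivP; exact: is_deriveM. Qed.

Lemma cderivZ (R : realType) (c : R[i]) (f : R[i] -> R[i]) z df :
  cderiv f z df -> cderiv (fun w => c * f w) z (c * df).
Proof.
move=> hf; have := cderivM (cderiv_cst c z) hf.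
by rewrite mulr0 addr0.
Qed.

Lemma cderivX (R : realType) (f : R[i] -> R[i]) n z df :
  cderiv f z df -> cderiv (fun w => f w ^+ n) z (n%:R * f z ^+ n.-1 * df).
Proof.
move=> hf; elim: n => [|n IH].
  by rewrite !mul0r; under eq_fun do rewrite expr0; exact: cderiv_cst.
under eq_fun do rewrite exprS.
have -> : n.+1%:R * f z ^+ n.+1.-1 * df =
    f z * (n%:R * f z ^+ n.-1 * df) + f z ^+ n * df.
  by case: n {IH} => [|n]; rewrite /= ?exprS -!natr1; ring.
exact: cderivM.
Qed.

Lemma cderivV (R : realType) (f : R[i] -> R[i]) z df : f z != 0 ->
  cderiv f z df -> cderiv (fun w => (f w)^-1) z (- (f z) ^- 2 * df).
Proof.
move=> fz /cderivP [/= hf <-]; apply/cderivP; split; first exact: derivableV.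
by rewrite deriveV.
Qed.

Lemma cderiv_unique (R : realType) (f : R[i] -> R[i]) z d1 d2 :
  cderiv f z d1 -> cderiv f z d2 -> d1 = d2.
Proof. by move=> /cderivP [/= _ <-] /cderivP [/= _ <-]. Qed.

Lemma cderiv_local (R : realType) (f g : R[i] -> R[i]) z d r : 0 < r ->
  (forall w, cmod (w - z) < r -> f w = g w) -> cderiv f z d -> cderiv g z d.
Proof.
move=> r0 fg hf e e0; have [s s0 sP] := hf e e0.
exists (Num.min r s); first by rewrite lt_min r0.
by move=> w; rewrite lt_min => /andP[wr ws]; rewrite -!fg// ?subrr ?cmod0// sP.
Qed.

Lemma cderiv_continuous (R : realType) (f : R[i] -> R[i]) z d :
  cderiv f z d -> forall e : R, 0 < e -> exists2 r : R, 0 < r &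
   forall w, cmod (w - z) < r -> cmod (f w - f z) < e.
Proof.
move=> hf e e0; have [r r0 rP] := hf 1 ltr01.
have d1 : 0 < 1 + cmod d by rewrite ltr_pwDl// cmod_ge0.
exists (Num.min r (e / (1 + cmod d))); first by rewrite lt_min r0 divr_gt0.
move=> w; rewrite lt_min ltr_pdivlMr// => /andP[/rP wr we].
have -> : f w - f z = (f w - f z - d * (w - z)) + d * (w - z) by rewrite subrK.
apply: le_lt_trans (cmod_le_add _ _) _; rewrite cmodM.
apply: le_lt_trans we.
rewrite [leRHS]mulrDr mulr1 [cmod d * _]mulrC lerD2r.
by rewrite -[leRHS]mul1r.
Qed.

Lemma cderiv_affine (R : realType) (f : R[i] -> R[i]) (a b z d : R[i]) :
  cderiv f (a + z * b) d -> cderiv (fun w => f (a + w * b)) z (b * d).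
Proof.
(* Dividing by 1 + |b| instead of |b| covers b = 0. *)
move=> hf e e0; have b1 : 0 < 1 + cmod b by rewrite ltr_pwDl// cmod_ge0.
have e1 : 0 < e / (1 + cmod b) by rewrite divr_gt0.
have [r r0 rP] := hf _ e1.
exists (r / (1 + cmod b)); first by rewrite divr_gt0.
move=> w; rewrite ltr_pdivlMr// => wr.
have E : a + w * b - (a + z * b) = (w - z) * b by ring.
have := rP (a + w * b); rewrite E cmodM => /(_ _).
have -> : d * ((w - z) * b) = b * d * (w - z) by ring.
have wb : cmod (w - z) * cmod b <= cmod (w - z) * (1 + cmod b).
  by rewrite ler_wpM2l ?cmod_ge0// lerDr.
move=> /(_ (le_lt_trans wb wr)) /le_trans; apply.
rewrite mulrAC ler_pdivrMr// -[leRHS]mulrA.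
by rewrite ler_pM2l.
Qed.

Lemma cderiv_horner (R : realType) (p : {poly R[i]}) z :
  cderiv (fun w => p.[w]) z p^`().[z].
Proof.
elim/poly_ind: p => [|p c hp].
  rewrite deriv0 horner0; under eq_fun do rewrite horner0; exact: cderiv_cst.
under eq_fun do rewrite hornerMXaddC.
rewrite derivMXaddC hornerD hornerMX.
have := cderivD (cderivM hp (cderiv_id z)) (cderiv_cst c z).
by rewrite mulr1 addr0 [z * _]mulrC.
Qed.

Definition rderiv (R : realType) (K : R -> R[i]) (s : R) (d : R[i]) : Prop :=
  forall e : R, 0 < e -> exists2 r : R, 0 < r &
    forall t, `|t - s| < r ->
      cmod (K t - K s - d * (t - s)%:C%C) <= e * `|t - s|.

(** Complex-valued functions have no mean value theorem, so a supremum is used: the set of [s] at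
    which the bound from [a] holds with slope M + e' contains its supremum, and the local bound
    there pushes past it unless it is [b]. *)
Lemma lipschitz_of_local (R : realType) (K : R -> R[i]) (a b M : R) : a <= b ->
  (forall s, a <= s <= b -> forall e, 0 < e -> exists2 r : R, 0 < r &
    forall t, `|t - s| < r -> cmod (K t - K s) <= (M + e) * `|t - s|) ->
  cmod (K b - K a) <= M * (b - a).
Proof.
move=> ab loc; apply/ler_addgt0Pr => e e0.
have [ba|ba] := eqVneq b a.
  by rewrite ba !subrr cmod0 mulr0 add0r ltW.
have ab0 : 0 < b - a by rewrite subr_gt0 lt_neqAle eq_sym ba.
pose e' := e / (b - a); have e'0 : 0 < e' by rewrite divr_gt0.
have -> : M * (b - a) + e = (M + e') * (b - a).
  by rewrite mulrDl /e' divfK// gt_eqF.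
pose S := [set s : R | [/\ a <= s, s <= b & cmod (K s - K a) <= (M + e') * (s - a)]].
have Sa : S a by split; rewrite ?lexx// !subrr cmod0 mulr0.
have hS : has_sup S by split; [exists a|exists b => s []].
have aT : a <= sup S by apply: ub_le_sup => //; case: hS.
have Tb : sup S <= b by apply: ge_sup; [exists a|move=> s []].
have Tab : a <= sup S <= b by rewrite aT Tb.
have [r r0 rP] := loc _ Tab _ e'0.
have ST : S (sup S).
  split=> //.
  have [s Ss sT] := sup_adherent r0 hS.
  have sT' : s <= sup S by apply: ub_le_sup => //; case: hS.
  have := rP s; rewrite distrC ger0_norm ?subr_ge0// => /(_ _) h.
  have {}h : cmod (K s - K (sup S)) <= (M + e') * (sup S - s) by apply: h; lra.
  case: Ss => _ _ hs.
  have -> : K (sup S) - K a = - (K s - K (sup S)) + (K s - K a) by ring.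
  by apply: le_trans (cmod_le_add _ _) _; rewrite cmodN; lra.
have [Tb'|Tb'] := ltP (sup S) b; last first.
  by have <- : sup S = b by [apply/eqP; rewrite eq_le Tb Tb']; case: ST.
pose t := Num.min b (sup S + r / 2).
have tT : sup S < t by rewrite /t lt_min Tb'; lra.
have tb : t <= b by rewrite /t ge_min lexx.
have tr : t - sup S < r.
  have : t <= sup S + r / 2 by rewrite /t ge_min lexx orbT.
  by lra.
suff : t <= sup S by rewrite leNgt tT.
apply: ub_le_sup; first by case: hS.
split=> //; first by lra.
case: ST => _ _ hs; have := rP t; rewrite ger0_norm; last lra.
move=> /(_ tr) h.
have -> : K t - K a = (K t - K (sup S)) + (K (sup S) - K a) by ring.
by apply: le_trans (cmod_le_add _ _) _; lra.
Qed.

(** Subtracting the linear function v s reduces to [lipschitz_of_local]. The case v = 0 is the plain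
    mean value inequality; a general [v] measures the deviation from an affine function. *)
Lemma rderiv_mean_value_le (R : realType) (K dK : R -> R[i]) (a b M : R) (v : R[i]) : a <= b ->
  (forall s, a <= s <= b -> rderiv K s (dK s)) ->
  (forall s, a <= s <= b -> cmod (dK s - v) <= M) ->
  cmod (K b - K a - v * (b - a)%:C%C) <= M * (b - a).
Proof.
move=> ab hK hM.
have -> : K b - K a - v * (b - a)%:C%C =
  (K b - v * b%:C%C) - (K a - v * a%:C%C) by rewrite rmorphB /=; ring.
apply: (@lipschitz_of_local _ (fun s => K s - v * s%:C%C)) => // s sab e e0.
have [r r0 rP] := hK s sab e e0; exists r => // t /rP h.
have -> : K t - v * t%:C%C - (K s - v * s%:C%C) =
  (K t - K s - dK s * (t - s)%:C%C) + (dK s - v) * (t - s)%:C%C.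
  by rewrite rmorphB /=; ring.
apply: le_trans (cmod_le_add _ _) _; rewrite cmodM cmod_real.
have := ler_wpM2r (normr_ge0 (t - s)) (hM s sab); lra.
Qed.

Lemma rderiv_cderiv (R : realType) (g : R[i] -> R[i]) (s : R) d :
  cderiv g s%:C%C d -> rderiv (fun t => g t%:C%C) s d.
Proof.
move=> hg e /hg [r r0 rP]; exists r => // t tr.
by have := rP t%:C%C; rewrite -rmorphB cmod_real; exact.
Qed.

Lemma rderiv_line (R : realType) (g : R[i] -> R[i]) (s : R) (a b d : R[i]) :
  cderiv g (a + s%:C%C * b) d ->
  rderiv (fun t => g (a + t%:C%C * b)) s (b * d).
Proof.
by move=> /cderiv_affine; exact: (@rderiv_cderiv _ (fun w => g (a + w * b))).
Qed.

Lemma cderiv_mean_value_le (R : realType) (g dg : R[i] -> R[i]) (z w v : R[i]) (M : R) :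
  (forall s : R, 0 <= s <= 1 -> cderiv g (z + s%:C%C * (w - z)) (dg (z + s%:C%C * (w - z)))) ->
  (forall s : R, 0 <= s <= 1 -> cmod (dg (z + s%:C%C * (w - z)) - v) <= M) ->
  cmod (g w - g z - v * (w - z)) <= M * cmod (w - z).
Proof.
move=> hg hM.
have := @rderiv_mean_value_le _ (fun s => g (z + s%:C%C * (w - z)))
  (fun s => (w - z) * dg (z + s%:C%C * (w - z))) 0 1 (M * cmod (w - z)) (v * (w - z)) ler01.
have -> : z + 0%:C%C * (w - z) = z by rewrite rmorph0; ring.
have -> : z + 1%:C%C * (w - z) = w by rewrite rmorph1; ring.
rewrite subr0 rmorph1 !mulr1; apply=> s /[dup] sP.
  by move=> /hg /rderiv_line.
move=> /hM h; rewrite [v * _]mulrC -mulrBr cmodM mulrC.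
by rewrite ler_wpM2r// cmod_ge0.
Qed.

Lemma antideriv_real (R : realType) (f : R -> R) (A : R) : continuous f ->
  exists F : R -> R, forall x, `|x| <= A -> is_derive x (1 : R) F (f x).
Proof.
(* Integrating from -B with B > |A| makes every x with |x| <= A an interior point, where the
   fundamental theorem gives a two-sided derivative. *)
move=> cf; pose B := `|A| + 1.
exists (fun x => (\int[lebesgue_measure]_(t in `[(- B), x]) f t)%R) => x xA.
have xB : `|x| < B by apply: le_lt_trans xA _; rewrite /B; have := ler_norm A; lra.
move: xB; rewrite ltr_norml => /andP[xB1 xB2].
have iB : lebesgue_measure.-integrable `[(- B), B] (EFin \o f).
  apply: continuous_compact_integrable; first exact: segment_compact.
  by apply: continuous_subspaceT.
have [dF F'] := continuous_FTC1_closed xB2 iB xB1 (cf x).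
by split; [exact: dF|rewrite -derive1E; exact: F'].
Qed.

(** * Goursat's lemma and primitives *)

Definition cpt (R : realType) (x y : R) : R[i] := x%:C%C + 'i%C * y%:C%C.

Lemma cptE (R : realType) (x y : R) : cpt x y = Complex x y.
Proof.
by rewrite /cpt; apply/eqP; rewrite eq_complex/= !mulr0 !mul0r !mul1r subrr addr0 !add0r !eqxx.
Qed.

Lemma cpt_ReIm (R : realType) (z : R[i]) : cpt (complex.Re z) (complex.Im z) = z.
Proof. by rewrite cptE; case: z. Qed.

Lemma cmodi (R : realType) : @cmod R 'i%C = 1.
Proof. by rewrite /cmod /= expr0n expr1n add0r sqrtr1. Qed.

Lemma cmod_cpt_le (R : realType) (x y : R) : cmod (cpt x y) <= `|x| + `|y|.
Proof.
by apply: le_trans (cmod_le_add _ _) _; rewrite cmodM cmodi mul1r !cmod_real.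
Qed.

Lemma Re_le_cmod (R : realType) (z : R[i]) : `|complex.Re z| <= cmod z.
Proof. by rewrite -lecR -normCE normc_ge_Re. Qed.

Lemma Im_le_cmod (R : realType) (z : R[i]) : `|complex.Im z| <= cmod z.
Proof.
by have := Re_le_cmod (z * 'i%C); rewrite ReiNIm normrN cmodM cmodi mulr1.
Qed.

(* [H y] stands for an antiderivative of s |-> g (s + iy) and [V x] for one of
   s |-> i g (x + is): the sum is then the integral of [g] over the boundary of
   the rectangle, without any path integral. *)
Definition boundary_sum (R : realType) (H V : R -> R -> R[i]) (x1 x2 y1 y2 : R) :=
  (H y1 x2 - H y1 x1) + (V x2 y2 - V x2 y1)
  - (H y2 x2 - H y2 x1) - (V x1 y2 - V x1 y1).

(* [al] is a primitive of the affine approximation of [g], whose own boundary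
   sum telescopes to 0. *)
Lemma boundary_sum_le (R : realType) (g : R[i] -> R[i]) (H V : R -> R -> R[i])
    (x1 x2 y1 y2 M : R) (c d z0 : R[i]) : x1 <= x2 -> y1 <= y2 ->
  (forall x y, x1 <= x <= x2 -> y1 <= y <= y2 -> rderiv (H y) x (g (cpt x y))) ->
  (forall x y, x1 <= x <= x2 -> y1 <= y <= y2 ->
     rderiv (V x) y ('i%C * g (cpt x y))) ->
  (forall x y, x1 <= x <= x2 -> y1 <= y <= y2 ->
     cmod (g (cpt x y) - c - d * (cpt x y - z0)) <= M) ->
  cmod (boundary_sum H V x1 x2 y1 y2) <= 2 * M * ((x2 - x1) + (y2 - y1)).
Proof.
move=> x12 y12 hH hV hM.
pose al (z : R[i]) := c * z + d / 2 * (z - z0) ^+ 2.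
have dal z : cderiv al z (c + d * (z - z0)).
  have := cderivD (cderivZ c (cderiv_id z))
    (cderivZ (d / 2) (cderivX 2 (cderivB (cderiv_id z) (cderiv_cst z0 z)))).
  rewrite subr0 !mulr1 expr1 -/al.
  by have -> : d / 2 * (2%:R * (z - z0)) = d * (z - z0) by field.
have hside y : y1 <= y <= y2 ->
    cmod (H y x2 - H y x1 - (al (cpt x2 y) - al (cpt x1 y))) <= M * (x2 - x1).
  move=> yP.
  have -> : H y x2 - H y x1 - (al (cpt x2 y) - al (cpt x1 y)) =
    (H y x2 - al (cpt x2 y)) - (H y x1 - al (cpt x1 y)) by ring.
  have := @rderiv_mean_value_le _ (fun s => H y s - al (cpt s y))
    (fun s => g (cpt s y) - (c + d * (cpt s y - z0))) x1 x2 M 0 x12.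
  rewrite mul0r !subr0; apply=> s sP; last first.
    by rewrite subr0 opprD addrA; exact: hM.
  move=> e e0; have e2 : 0 < e / 2 by rewrite divr_gt0.
  have [r r0 rP] := hH s y sP yP _ e2.
  have := dal (cpt s y).
  have -> : cpt s y = 'i%C * y%:C%C + s%:C%C * 1 by rewrite /cpt; ring.
  move=> /rderiv_line /(_ _ e2)[t t0 tP].
  exists (Num.min r t) => [|u]; first by rewrite lt_min r0.
  rewrite lt_min => /andP[/rP h1 /tP].
  rewrite !mulr1 mul1r.
  have <- : cpt u y = 'i%C * y%:C%C + u%:C%C by rewrite /cpt; ring.
  have <- : cpt s y = 'i%C * y%:C%C + s%:C%C by rewrite /cpt; ring.
  move: h1; set q := (u - s)%:C%C => h1 h2.
  have -> : H y u - al (cpt u y) - (H y s - al (cpt s y)) -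
     (g (cpt s y) - (c + d * (cpt s y - z0))) * q =
    (H y u - H y s - g (cpt s y) * q) -
      (al (cpt u y) - al (cpt s y) - (c + d * (cpt s y - z0)) * q) by ring.
  by apply: le_trans (cmod_le_add _ _) _; rewrite cmodN; lra.
have vside x : x1 <= x <= x2 ->
    cmod (V x y2 - V x y1 - (al (cpt x y2) - al (cpt x y1))) <= M * (y2 - y1).
  move=> xP.
  have -> : V x y2 - V x y1 - (al (cpt x y2) - al (cpt x y1)) =
    (V x y2 - al (cpt x y2)) - (V x y1 - al (cpt x y1)) by ring.
  have := @rderiv_mean_value_le _ (fun s => V x s - al (cpt x s))
    (fun s => 'i%C * (g (cpt x s) - (c + d * (cpt x s - z0)))) y1 y2 M 0 y12.
  rewrite mul0r !subr0; apply=> s sP; last first.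
    by rewrite subr0 opprD addrA cmodM cmodi mul1r; exact: hM.
  move=> e e0; have e2 : 0 < e / 2 by rewrite divr_gt0.
  have [r r0 rP] := hV x s xP sP _ e2.
  have := dal (cpt x s).
  have -> : cpt x s = x%:C%C + s%:C%C * 'i%C by rewrite /cpt; ring.
  move=> /rderiv_line /(_ _ e2)[t t0 tP].
  exists (Num.min r t) => [|u]; first by rewrite lt_min r0.
  rewrite lt_min => /andP[/rP h1 /tP].
  have <- : cpt x u = x%:C%C + u%:C%C * 'i%C by rewrite /cpt; ring.
  have <- : cpt x s = x%:C%C + s%:C%C * 'i%C by rewrite /cpt; ring.
  move: h1; set q := (u - s)%:C%C => h1 h2.
  have -> : V x u - al (cpt x u) - (V x s - al (cpt x s)) -
     'i%C * (g (cpt x s) - (c + d * (cpt x s - z0))) * q =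
    (V x u - V x s - 'i%C * g (cpt x s) * q) -
      (al (cpt x u) - al (cpt x s) - 'i%C * (c + d * (cpt x s - z0)) * q) by ring.
  by apply: le_trans (cmod_le_add _ _) _; rewrite cmodN; lra.
have y1P : y1 <= y1 <= y2 by rewrite lexx.
have y2P : y1 <= y2 <= y2 by rewrite lexx andbT.
have x1P : x1 <= x1 <= x2 by rewrite lexx.
have x2P : x1 <= x2 <= x2 by rewrite lexx andbT.
have h1 := hside _ y1P; have h2 := hside _ y2P.
have h3 := vside _ x1P; have h4 := vside _ x2P.
rewrite /boundary_sum.
move: h1 h2 h3 h4; set a1 := al _; set a2 := al _; set a3 := al _; set a4 := al _.
set b1 := _ - _ - (_ - _); set b2 := _ - _ - (_ - _).
set b3 := _ - _ - (_ - _); set b4 := _ - _ - (_ - _) => h1 h2 h3 h4.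
have -> : H y1 x2 - H y1 x1 + (V x2 y2 - V x2 y1) - (H y2 x2 - H y2 x1) -
   (V x1 y2 - V x1 y1) = (b1 + b4) - (b2 + b3) by rewrite /b1 /b2 /b3 /b4; ring.
have := cmod_le_add (b1 + b4) (- (b2 + b3)); rewrite cmodN.
have := cmod_le_add b1 b4; have := cmod_le_add b2 b3; lra.
Qed.

Lemma nested_halving (R : realType) (a : nat -> R) (w : R) : 0 <= w ->
  (forall n, a n <= a n.+1) ->
  (forall n, a n.+1 + w / 2 ^+ n.+1 <= a n + w / 2 ^+ n) ->
  exists x, forall n, a n <= x <= a n + w / 2 ^+ n.
Proof.
move=> w0 aS bS.
have wn n : 0 <= w / 2 ^+ n by rewrite divr_ge0// exprn_ge0.
have a_le m n : a m <= a (m + n)%N.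
  by elim: n => [|n IH]; rewrite ?addn0 ?lexx// addnS (le_trans IH).
have b_le m n : a (m + n)%N + w / 2 ^+ (m + n) <= a m + w / 2 ^+ m.
  by elim: n => [|n IH]; rewrite ?addn0 ?lexx// addnS (le_trans (bS _)).
have ub m n : a m <= a n + w / 2 ^+ n.
  have := a_le m n; have := b_le n m; have := wn (n + m)%N.
  by rewrite (addnC m n); lra.
have hS : has_sup (range a).
  by split; [exists (a 0%N), 0%N|exists (a 0%N + w / 2 ^+ 0) => _ [m _ <-]].
exists (sup (range a)) => n; apply/andP; split.
  by apply: ub_le_sup; [case: hS|exists n].
by apply: ge_sup; [case: hS|move=> _ [m _ <-]].
Qed.

(** The inner sides are run through twice, in opposite directions, and cancel. *)
Lemma boundary_sum_split (R : realType) (H V : R -> R -> R[i])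
    (x1 x x2 y1 y y2 : R) :
  boundary_sum H V x1 x2 y1 y2 =
  boundary_sum H V x1 x y1 y + boundary_sum H V x x2 y1 y +
  boundary_sum H V x1 x y y2 + boundary_sum H V x x2 y y2.
Proof. by rewrite /boundary_sum; ring. Qed.

Lemma boundary_sum_quarter (R : realType) (H V : R -> R -> R[i]) (x y w h : R) :
  0 <= w -> 0 <= h -> exists x' y' : R,
  [/\ x <= x', x' + w <= x + (w + w), y <= y', y' + h <= y + (h + h) &
      cmod (boundary_sum H V x (x + (w + w)) y (y + (h + h))) <=
      4 * cmod (boundary_sum H V x' (x' + w) y' (y' + h))].
Proof.
move=> w0 h0; rewrite !addrA (boundary_sum_split H V x (x + w) _ y (y + h)).
set J1 := boundary_sum _ _ x _ y _; set J2 := boundary_sum _ _ _ _ y _.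
set J3 := boundary_sum _ _ x _ _ _; set J4 := boundary_sum _ _ _ _ _ _.
have := cmod_le_add (J1 + J2 + J3) J4; have := cmod_le_add (J1 + J2) J3.
have := cmod_le_add J1 J2; set S := cmod (_ + J4) => l1 l2 l3.
have [c1|c1] := leP S (4 * cmod J1); first by exists x, y; split=> //; lra.
have [c2|c2] := leP S (4 * cmod J2); first by exists (x + w), y; split=> //; lra.
have [c3|c3] := leP S (4 * cmod J3); first by exists x, (y + h); split=> //; lra.
by exists (x + w), (y + h); split; rewrite -/J4 //; lra.
Qed.

(* Quarter the rectangle repeatedly, always keeping a quarter with the largest
   boundary sum, and compare with the affine approximation at the limit point. *)
Lemma goursat (R : realType) (g : R[i] -> R[i]) (H V : R -> R -> R[i])
    (x1 x2 y1 y2 : R) : x1 <= x2 -> y1 <= y2 ->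
  (forall x y, x1 <= x <= x2 -> y1 <= y <= y2 -> exists d, cderiv g (cpt x y) d) ->
  (forall x y, x1 <= x <= x2 -> y1 <= y <= y2 -> rderiv (H y) x (g (cpt x y))) ->
  (forall x y, x1 <= x <= x2 -> y1 <= y <= y2 ->
     rderiv (V x) y ('i%C * g (cpt x y))) ->
  boundary_sum H V x1 x2 y1 y2 = 0.
Proof.
move=> x12 y12 hg hH hV; apply/eqP/negP => /negP /cmod_gt0.
set eta := cmod _ => eta0.
pose w := x2 - x1; pose h := y2 - y1.
have w0 : 0 <= w by rewrite subr_ge0.
have h0 : 0 <= h by rewrite subr_ge0.
have p20 n : 0 < (2 : R) ^+ n by rewrite exprn_gt0.
have wn n : 0 <= w / 2 ^+ n by rewrite divr_ge0// ltW.
have hn n : 0 <= h / 2 ^+ n by rewrite divr_ge0// ltW.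
pose J n (p : R * R) :=
  boundary_sum H V p.1 (p.1 + w / 2 ^+ n) p.2 (p.2 + h / 2 ^+ n).
(* The state is the lower left corner of the current rectangle; the side lengths follow from the
   index, which is paired with it so that [choice] yields a single function. *)
have step (np : nat * (R * R)) : exists q : R * R,
  [/\ np.2.1 <= q.1, q.1 + w / 2 ^+ np.1.+1 <= np.2.1 + w / 2 ^+ np.1,
      np.2.2 <= q.2, q.2 + h / 2 ^+ np.1.+1 <= np.2.2 + h / 2 ^+ np.1 &
      cmod (J np.1 np.2) <= 4 * cmod (J np.1.+1 q)].
  case: np => n [x y] /=.
  have halve (u : R) : u / 2 ^+ n = u / 2 ^+ n.+1 + u / 2 ^+ n.+1.
    by rewrite exprS; field; rewrite expf_neq0.
  have [x' [y' [x'1 x'2 y'1 y'2 le4]]] :=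
    boundary_sum_quarter H V x y (wn n.+1) (hn n.+1).
  by exists (x', y'); split=> //=; rewrite ?(halve w) ?(halve h)// /J /= (halve w) (halve h).
have [f fP] := choice step.
pose s := fix s n := if n is m.+1 then f (m, s m) else (x1, y1).
have sP n : [/\ (s n).1 <= (s n.+1).1,
     (s n.+1).1 + w / 2 ^+ n.+1 <= (s n).1 + w / 2 ^+ n,
     (s n).2 <= (s n.+1).2,
     (s n.+1).2 + h / 2 ^+ n.+1 <= (s n).2 + h / 2 ^+ n &
     cmod (J n (s n)) <= 4 * cmod (J n.+1 (s n.+1))] by exact: (fP (n, s n)).
have [X XP] : exists x, forall n, (s n).1 <= x <= (s n).1 + w / 2 ^+ n.
  by apply: nested_halving => // n; case: (sP n).
have [Y YP] : exists y, forall n, (s n).2 <= y <= (s n).2 + h / 2 ^+ n.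
  by apply: nested_halving => // n; case: (sP n).
have inx n : x1 <= (s n).1 /\ (s n).1 + w / 2 ^+ n <= x2.
  elim: n => [|n [h1 h2]]; last by case: (sP n) => *; lra.
  by rewrite /= expr0 divr1 /w; split; lra.
have iny n : y1 <= (s n).2 /\ (s n).2 + h / 2 ^+ n <= y2.
  elim: n => [|n [h1 h2]]; last by case: (sP n) => *; lra.
  by rewrite /= expr0 divr1 /h; split; lra.
have Jn n : eta <= 4 ^+ n * cmod (J n (s n)).
  elim: n => [|n IH].
    rewrite expr0 mul1r /J /= expr0 !divr1 /w /h !(addrC _ (_ - _)) !subrK.
    exact: lexx.
  apply: le_trans IH _; rewrite exprSr -mulrA ler_wpM2l ?exprn_ge0//.
  by case: (sP n).
have XX : x1 <= X <= x2 by move: (XP 0%N) (inx 0%N) => *; lra.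
have YY : y1 <= Y <= y2 by move: (YP 0%N) (iny 0%N) => *; lra.
have [d hd] := hg X Y XX YY.
(* On the n-th rectangle the affine error is at most eta / K * (w + h) / 2^n, so 4^n times its
   boundary sum is at most 2 * eta / K * (w + h)^2. This [K] makes that less than [eta]; the + 1
   also serves degenerate rectangles. *)
pose K := 2 * (w + h) ^+ 2 + 1.
have K0 : 0 < K by rewrite ltr_wpDl// mulr_ge0// sqr_ge0.
have e0 : 0 < eta / K by rewrite divr_gt0.
have [r r0 rP] := hd _ e0.
have [n nP] : exists n, (w + h) / 2 ^+ n < r.
  have rw0 : 0 < r / (w + h + 1) by rewrite divr_gt0//; lra.
  have [n nP] := ltr_add_invr rw0.
  exists n; rewrite ltr_pdivrMr//.
  have n2 : (n.+1%:R : R) <= 2 ^+ n.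
    by rewrite -natrX ler_nat ltn_expl.
  move: nP; rewrite add0r ltr_pdivlMr; last lra.
  rewrite mulrC ltr_pdivrMr ?ltr0n// => nP.
  have : r * n.+1%:R <= r * 2 ^+ n by rewrite ler_pM2l.
  by lra.
have Jle : cmod (J n (s n)) <= 2 * (eta / K * ((w + h) / 2 ^+ n)) * ((w + h) / 2 ^+ n).
  have [xa xb] := inx n; have [ya yb] := iny n.
  have := @boundary_sum_le _ g H V (s n).1 ((s n).1 + w / 2 ^+ n)
    (s n).2 ((s n).2 + h / 2 ^+ n) (eta / K * ((w + h) / 2 ^+ n)) (g (cpt X Y)) d (cpt X Y).
  have addl (u v : R) : u + v - u = v by ring.
  rewrite !addl -mulrDl; apply.
  - by rewrite lerDl.
  - by rewrite lerDl.
  - by move=> x y xP yP; apply: hH; lra.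
  - by move=> x y xP yP; apply: hV; lra.
  - move=> x y xP yP.
    have zle : cmod (cpt x y - cpt X Y) <= (w + h) / 2 ^+ n.
      have -> : cpt x y - cpt X Y = cpt (x - X) (y - Y).
        by rewrite /cpt !rmorphB /=; ring.
      apply: le_trans (cmod_cpt_le _ _) _; rewrite mulrDl.
      have := XP n; have := YP n.
      by apply: (fun _ _ => lerD _ _) => //; rewrite ler_norml; lra.
    apply: le_trans (rP _ (le_lt_trans zle nP)) _.
    by rewrite ler_pM2l.
have := Jn n.
have : 4 ^+ n * cmod (J n (s n)) <= 2 * (eta / K) * (w + h) ^+ 2.
  have -> : 2 * (eta / K) * (w + h) ^+ 2 =
    4 ^+ n * (2 * (eta / K * ((w + h) / 2 ^+ n)) * ((w + h) / 2 ^+ n)).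
    have -> : (4 : R) ^+ n = 2 ^+ n * 2 ^+ n by rewrite -exprMn; congr (_ ^+ _); ring.
    by field; rewrite expf_neq0 ?gt_eqF.
  by rewrite ler_pM2l// exprn_gt0.
have : eta / K * K = eta by rewrite divfK// gt_eqF.
by rewrite /K; set u := eta / _; have : 0 < u by []; lra.
Qed.

Lemma is_derive_eps (R : realType) (F : R -> R) (x d : R) :
  is_derive x (1 : R) F d -> forall e : R, 0 < e -> exists2 r : R, 0 < r &
    forall t, `|t - x| < r -> `|F t - F x - d * (t - x)| <= e * `|t - x|.
Proof.
move=> [/= dF <-] e e0; have /cvgrPdist_le /(_ e e0) := dF.
rewrite near_withinE => /nbhs_ballP[r /= r0 rP].
exists r => // t tr; have [->|tx] := eqVneq t x.
  by rewrite !subrr mulr0 subrr normr0 mulr0.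
have := rP (t - x); rewrite /ball /= sub0r normrN => /(_ tr).
rewrite subr_eq0 => /(_ tx); set D := lim _.
have -> : D - (t - x)^-1 *: (F ((t - x) *: 1 + x) - F x) =
     - ((t - x)^-1 * (F t - F x - D * (t - x))).
  by rewrite /GRing.scale/= mulr1 subrK; field; rewrite ?subr_eq0.
rewrite normrN normrM normfV ler_pdivrMl ?normr_gt0 ?subr_eq0//.
by rewrite [leRHS]mulrC.
Qed.

Lemma rderiv_cpt (R : realType) (F1 F2 : R -> R) (x d1 d2 : R) :
  is_derive x (1 : R) F1 d1 -> is_derive x (1 : R) F2 d2 ->
  rderiv (fun s => cpt (F1 s) (F2 s)) x (cpt d1 d2).
Proof.
move=> /is_derive_eps h1 /is_derive_eps h2 e e0.
have e2 : 0 < e / 2 by rewrite divr_gt0.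
have [r r0 rP] := h1 _ e2; have [s s0 sP] := h2 _ e2.
exists (Num.min r s) => [|t]; first by rewrite lt_min r0.
rewrite lt_min => /andP[/rP l1 /sP l2].
have -> : cpt (F1 t) (F2 t) - cpt (F1 x) (F2 x) - cpt d1 d2 * (t - x)%:C%C =
  cpt (F1 t - F1 x - d1 * (t - x)) (F2 t - F2 x - d2 * (t - x)).
  by rewrite /cpt !rmorphB !rmorphM !rmorphB /=; ring.
by apply: le_trans (cmod_cpt_le _ _) _; lra.
Qed.

Lemma antideriv_complex (R : realType) (c : R -> R[i]) (A : R) :
  (forall s (e : R), 0 < e -> exists2 r : R, 0 < r &
     forall t, `|t - s| < r -> cmod (c t - c s) < e) ->
  exists K : R -> R[i], forall s, `|s| <= A -> rderiv K s (c s).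
Proof.
move=> cc.
have c1 : continuous (fun s => complex.Re (c s)).
  move=> s; apply/cvgrPdist_lt => e e0; have [r r0 rP] := cc s e e0.
  apply/nbhs_ballP; exists r => //= t; rewrite /ball/= distrC => /rP.
  rewrite cmod_distC; apply: le_lt_trans; apply: le_trans (Re_le_cmod _).
  by case: (c s) (c t) => [? ?] [? ?].
have c2 : continuous (fun s => complex.Im (c s)).
  move=> s; apply/cvgrPdist_lt => e e0; have [r r0 rP] := cc s e e0.
  apply/nbhs_ballP; exists r => //= t; rewrite /ball/= distrC => /rP.
  rewrite cmod_distC; apply: le_lt_trans; apply: le_trans (Im_le_cmod _).
  by case: (c s) (c t) => [? ?] [? ?].
have [F1 h1] := antideriv_real A c1; have [F2 h2] := antideriv_real A c2.
exists (fun s => cpt (F1 s) (F2 s)) => s sA.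
by rewrite -[c s]cpt_ReIm; apply: rderiv_cpt; [exact: h1|exact: h2].
Qed.

Definition clampr (R : realType) (A x : R) : R := Num.max (- A) (Num.min A x).

Lemma clampr_le (R : realType) (A x : R) : 0 <= A -> `|clampr A x| <= A.
Proof.
move=> A0; rewrite ler_norml /clampr le_max lexx /= ge_max ge_min lexx /= andbT.
by lra.
Qed.

Lemma clampr_id (R : realType) (A x : R) : `|x| <= A -> clampr A x = x.
Proof.
by rewrite ler_norml => /andP[h1 h2]; rewrite /clampr (min_idPr h2) (max_idPr h1).
Qed.

Lemma clampr_lip (R : realType) (A x y : R) : 0 <= A ->
  `|clampr A x - clampr A y| <= `|x - y|.
Proof.
move=> A0; rewrite /clampr; have := ler_norm (x - y).
have := ler_norm (- (x - y)); rewrite normrN ler_norml.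
by case: (leP A x) => h1; case: (leP A y) => h2;
  try case: (leP (- A) x) => h3; try case: (leP (- A) y) => h4;
  try case: (leP (- A) A) => h5; lra.
Qed.

Lemma convex_abs_le (R : realType) (u v t M : R) :
  `|u| < M -> `|v| < M -> 0 <= t <= 1 -> `|u + t * (v - u)| <= M.
Proof.
move=> uM vM tP; have -> : u + t * (v - u) = (1 - t) * u + t * v by ring.
apply: le_trans (ler_normD _ _) _; rewrite !normrM.
rewrite (ger0_norm (x := t)) ?(ger0_norm (x := 1 - t)); try lra.
by nra.
Qed.

Lemma abs_mul_le (R : realType) (t u : R) : 0 <= t <= 1 -> `|t * u| <= `|u|.
Proof.
by move=> tP; rewrite normrM ger0_norm; [have := normr_ge0 u; nra|lra].
Qed.

Lemma segment_param (R : realType) (t a b : R) : a < b -> a <= t <= b ->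
  exists2 q, 0 <= q <= 1 & t = a + q * (b - a).
Proof.
move=> ab /andP[a_t tb]; have ba : 0 < b - a by rewrite subr_gt0.
exists ((t - a) / (b - a)); last by rewrite divfK ?gt_eqF// addrC subrK.
by rewrite ler_pdivrMr// mul1r lerD2r tb divr_ge0 ?subr_ge0// ltW.
Qed.

Lemma segment_mean_value_le (R : realType) (K k : R -> R[i]) (u v : R)
    (c : R[i]) (M : R) :
  (forall t, 0 <= t <= 1 -> rderiv K (u + t * (v - u)) (k (u + t * (v - u)))) ->
  (forall t, 0 <= t <= 1 -> cmod (k (u + t * (v - u)) - c) <= M) ->
  cmod (K v - K u - c * (v - u)%:C%C) <= M * `|v - u|.
Proof.
move=> hK hM; have [uv|uv|->] := ltgtP u v.
- rewrite ger0_norm; last lra.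
  apply: (@rderiv_mean_value_le _ K k) => [|t tP|t tP]; first exact: ltW.
    by have [q q01 ->] := segment_param uv tP; exact: hK.
  by have [q q01 ->] := segment_param uv tP; exact: hM.
- rewrite distrC ger0_norm; last lra.
  have -> : K v - K u - c * (v - u)%:C%C = - (K u - K v - c * (u - v)%:C%C).
    by rewrite !rmorphB /=; ring.
  rewrite cmodN; have flip q : v + q * (u - v) = u + (1 - q) * (v - u) by ring.
  apply: (@rderiv_mean_value_le _ K k) => [|t tP|t tP]; first exact: ltW.
    by have [q q01 ->] := segment_param uv tP; rewrite flip; apply: hK; lra.
  by have [q q01 ->] := segment_param uv tP; rewrite flip; apply: hM; lra.
- by rewrite !subrr rmorph0 mulr0 subr0 cmod0 normr0 mulr0.
Qed.

(* Clamping the coordinates to [-r, r] makes [g] continuous on the whole plane,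
   so that the antiderivatives on the sides are two-sided at the end points. *)
Lemma primitive_exists (R : realType) (g : R[i] -> R[i]) (r : R) : 0 < r ->
  (forall z, cmod z < 3 * r -> exists d, cderiv g z d) ->
  exists G : R[i] -> R[i], forall z, cmod z < r -> cderiv G z (g z).
Proof.
move=> r0 hg; have r0' := ltW r0.
(* Points of the square of half-side [r] have modulus at most 2 r, hence the 3 r of the
   hypothesis. *)
have hgc x y : `|x| <= r -> `|y| <= r -> exists d, cderiv g (cpt x y) d.
  by move=> xr yr; apply: hg; apply: le_lt_trans (cmod_cpt_le _ _) _; lra.
pose gc x y := g (cpt (clampr r x) (clampr r y)).
have gcE x y : `|x| <= r -> `|y| <= r -> gc x y = g (cpt x y).
  by move=> xr yr; rewrite /gc !clampr_id.
have gc_cont x y (e : R) : 0 < e -> exists2 s : R, 0 < s &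
    forall x' y', `|x' - x| + `|y' - y| < s -> cmod (gc x' y' - gc x y) < e.
  move=> e0; have [d hd] := hgc _ _ (clampr_le x r0') (clampr_le y r0').
  have [s s0 sP] := cderiv_continuous hd e0; exists s => // x' y' h.
  apply: sP; apply: le_lt_trans h.
  have -> : cpt (clampr r x') (clampr r y') - cpt (clampr r x) (clampr r y) =
    cpt (clampr r x' - clampr r x) (clampr r y' - clampr r y).
    by rewrite /cpt !rmorphB /=; ring.
  by apply: le_trans (cmod_cpt_le _ _) _; apply: lerD; exact: clampr_lip.
have /choice[H hH] : forall y, exists Hy : R -> R[i], forall x, `|x| <= r ->
    rderiv Hy x (gc x y).
  move=> y; apply: antideriv_complex => x e /(gc_cont x y)[s s0 sP]; exists s => // t ts.
  by apply: sP; rewrite subrr normr0 addr0.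
have /choice[V hV] : forall x, exists Vx : R -> R[i], forall y, `|y| <= r ->
    rderiv Vx y ('i%C * gc x y).
  move=> x; apply: (@antideriv_complex _ (fun y => 'i%C * gc x y)) => y e.
  move=> /(gc_cont x y)[s s0 sP]; exists s => // t ts.
  by rewrite -mulrBr cmodM cmodi mul1r; apply: sP; rewrite subrr normr0 add0r.
have hH' x y : `|x| <= r -> `|y| <= r -> rderiv (H y) x (g (cpt x y)).
  by move=> xr yr; rewrite -gcE//; exact: hH.
have hV' x y : `|x| <= r -> `|y| <= r -> rderiv (V x) y ('i%C * g (cpt x y)).
  by move=> xr yr; rewrite -gcE//; exact: hV.
have gou x1 x2 y1 y2 : `|x1| <= r -> `|x2| <= r -> `|y1| <= r -> `|y2| <= r ->
    boundary_sum H V x1 x2 y1 y2 = 0.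
  have gou1 a1 a2 b1 b2 : `|a1| <= r -> `|a2| <= r -> `|b1| <= r -> `|b2| <= r ->
      a1 <= a2 -> b1 <= b2 -> boundary_sum H V a1 a2 b1 b2 = 0.
    rewrite !ler_norml => h1 h2 h3 h4 h5 h6.
    have inr u v w : -r <= u -> v <= r -> u <= w <= v -> `|w| <= r.
      by move=> *; rewrite ler_norml; lra.
    by apply: (@goursat _ g) => // x y /inr xr /inr yr;
      [apply: hgc|apply: hH'|apply: hV']; (apply: xr || apply: yr); lra.
  move=> h1 h2 h3 h4.
  have swx a1 a2 b1 b2 : boundary_sum H V a1 a2 b1 b2 = - boundary_sum H V a2 a1 b1 b2.
    by rewrite /boundary_sum; ring.
  have swy a1 a2 b1 b2 : boundary_sum H V a1 a2 b1 b2 = - boundary_sum H V a1 a2 b2 b1.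
    by rewrite /boundary_sum; ring.
  have [x12|/ltW x12] := leP x1 x2; have [y12|/ltW y12] := leP y1 y2.
  - exact: gou1.
  - by rewrite swy gou1// oppr0.
  - by rewrite swx gou1// oppr0.
  - by rewrite swx swy gou1// !oppr0.
have rr0 : `|0 : R| <= r by rewrite normr0.
(* The integral of [g] from 0 along the real axis to Re z, then vertically to z. *)
exists (fun z => H 0 (complex.Re z) - H 0 0 + V (complex.Re z) (complex.Im z)
  - V (complex.Re z) 0) => z zr e e0.
pose x := complex.Re z; pose y := complex.Im z.
have xr : `|x| < r := le_lt_trans (Re_le_cmod z) zr.
have yr : `|y| < r := le_lt_trans (Im_le_cmod z) zr.
have e2 : 0 < e / 2 by rewrite divr_gt0.
have zE : z = cpt x y by rewrite cpt_ReIm.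
have [s s0 sP] := gc_cont x y _ e2.
exists (Num.min s (r - cmod z) / 2).
  by rewrite divr_gt0// lt_min s0 subr_gt0.
move=> w wz; pose x' := complex.Re w; pose y' := complex.Im w.
have wE : w = cpt x' y' by rewrite cpt_ReIm.
have [ws wr] : cmod (w - z) * 2 < s /\ cmod (w - z) * 2 < r - cmod z.
  by move: wz; rewrite ltr_pdivlMr// lt_min => /andP.
have wr' : cmod w < r.
  have := cmod_le_add (w - z) z; rewrite subrK.
  by have := cmod_ge0 (w - z); lra.
have x'r : `|x'| < r := le_lt_trans (Re_le_cmod w) wr'.
have y'r : `|y'| < r := le_lt_trans (Im_le_cmod w) wr'.
have wzE : w - z = cpt (x' - x) (y' - y) by rewrite wE zE /cpt !rmorphB /=; ring.
have dx : `|x' - x| <= cmod (w - z).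
  by have := Re_le_cmod (w - z); rewrite wzE cptE.
have dy : `|y' - y| <= cmod (w - z).
  by have := Im_le_cmod (w - z); rewrite wzE cptE.
rewrite -/x -/y -/x' -/y'.
(* Goursat on [x, x'] x [0, y] lifts the horizontal step from height 0 to height y: the increment is
   now taken along two short segments near [z], on which [g] is within e / 2 of [g z]. *)
have -> : H 0 x' - H 0 0 + V x' y' - V x' 0 - (H 0 x - H 0 0 + V x y - V x 0)
  - g z * (w - z) = (H y x' - H y x - g z * (x' - x)%:C%C) +
     (V x' y' - V x' y - 'i%C * g z * (y' - y)%:C%C).
  have := gou x x' 0 y (ltW xr) (ltW x'r) rr0 (ltW yr); rewrite /boundary_sum => G0.
  rewrite -[LHS]subr0 -G0 wzE /cpt !rmorphB /=; ring.
have l1 : cmod (H y x' - H y x - g z * (x' - x)%:C%C) <= e / 2 * `|x' - x|.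
  apply: (@segment_mean_value_le _ _ (fun t => g (cpt t y))) => t t01.
    by apply: hH'; [exact: convex_abs_le|exact: ltW].
  rewrite zE -!gcE ?(ltW xr) ?(ltW yr) ?(ltW x'r) ?convex_abs_le//; apply: ltW; apply: sP.
  rewrite addrAC subrr add0r subrr normr0 addr0.
  by have := abs_mul_le (x' - x) t01; have := cmod_ge0 (w - z); lra.
have l2 : cmod (V x' y' - V x' y - 'i%C * g z * (y' - y)%:C%C) <= e / 2 * `|y' - y|.
  apply: (@segment_mean_value_le _ _ (fun t => 'i%C * g (cpt x' t))) => t t01.
    by apply: hV'; [exact: ltW|exact: convex_abs_le].
  rewrite -mulrBr cmodM cmodi mul1r zE.
  rewrite -!gcE ?(ltW xr) ?(ltW yr) ?(ltW x'r) ?convex_abs_le//; apply: ltW; apply: sP.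
  rewrite [_ + _ - y]addrAC subrr add0r.
  by have := abs_mul_le (y' - y) t01; lra.
apply: le_trans (cmod_le_add _ _) _.
have : e / 2 * `|x' - x| <= e / 2 * cmod (w - z) by rewrite ler_pM2l.
have : e / 2 * `|y' - y| <= e / 2 * cmod (w - z) by rewrite ler_pM2l.
by lra.
Qed.

(** * Maximum principle *)

Lemma cmod_continuous (R : realType) : continuous (fun z : Cplx R => cmod z : R).
Proof.
move=> z; apply/(@cvgrPdist_lt R R^o _ (nbhs (z : Cplx R))) => e e0.
apply/near_cmodP; exists e => // w wz.
apply: le_lt_trans wz; rewrite ler_norml.
have := cmod_le_add (w - z) z; rewrite subrK.
have := cmod_le_add (z - w) w; rewrite subrK (cmod_distC z w); lra.
Qed.

Lemma compact_disc (R : realType) (rho : R) :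
  compact [set z : Cplx R | cmod z <= rho].
Proof.
have cc : compact ((fun p : R * R => cpt p.1 p.2 : Cplx R) @`
    (`[- rho, rho] `*` `[- rho, rho])).
  apply: continuous_compact; last by apply: compact_setX; exact: segment_compact.
  apply: continuous_subspaceT => p; apply/cvgrPdist_lt => e e0.
  have eE : e = (complex.Re e)%:C%C by rewrite RRe_real// gtr0_real.
  have e0' : 0 < complex.Re e / 2 by rewrite divr_gt0// -ltcR -eE.
  apply/(@nbhs_ballP R (R * R)%type); exists (complex.Re e / 2) => //= q [q1 q2].
  rewrite normCE eE ltcR.
  have -> : cpt p.1 p.2 - cpt q.1 q.2 = cpt (p.1 - q.1) (p.2 - q.2).
    by rewrite /cpt !rmorphB /=; ring.
  apply: le_lt_trans (cmod_cpt_le _ _) _.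
  by move: q1 q2; rewrite /ball /=; lra.
apply: subclosed_compact cc _.
  rewrite -[X in closed X]/((fun z : Cplx R => cmod z) @^-1` [set x : R | x <= rho]).
  apply: closed_comp => [z _|]; [exact: cmod_continuous|exact: closed_le].
move=> z /= zr; exists (complex.Re z, complex.Im z); last exact: cpt_ReIm.
have := Re_le_cmod z; have := Im_le_cmod z; rewrite !ler_norml.
by move=> h1 h2; split; rewrite /= in_itv/=; lra.
Qed.

Lemma disc_max (R : realType) (u : R[i] -> R) (rho : R) : 0 <= rho ->
  (forall z, cmod z <= rho -> forall e : R, 0 < e -> exists2 r : R, 0 < r &
     forall w, cmod (w - z) < r -> `|u w - u z| < e) ->
  exists2 z, cmod z <= rho & forall w, cmod w <= rho -> u w <= u z.
Proof.
move=> rho0 uc; have ne : [set z : Cplx R | cmod z <= rho] !=set0.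
  by exists (0 : R[i]); move: rho0; rewrite -{1}(cmod0 R).
have := @compact_EVT_max _ R (u : Cplx R -> R) _ ne (@compact_disc R rho).
case=> [|z]; last by rewrite inE => zr h; exists z => // w wr; apply: h; rewrite inE.
apply: continuous_in_subspaceT => z; rewrite inE /= => zr.
apply/(@cvgrPdist_lt R R^o _ (nbhs (z : Cplx R))) => e e0; apply/near_cmodP.
have [r r0 rP] := uc z zr e e0.
by exists r => // w /rP; rewrite distrC.
Qed.

Lemma sqr_cmodD (R : realType) (z h : R[i]) :
  cmod (z + h) ^+ 2 = cmod z ^+ 2 + cmod h ^+ 2 + 2 * complex.Re (conjc z * h).
Proof.
case: z h => a b [c d]; rewrite /cmod /= !sqr_sqrtr ?addr_ge0 ?sqr_ge0//; ring.
Qed.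

Lemma sqr_cmodD_ge (R : realType) (z h : R[i]) :
  cmod z ^+ 2 + 2 * complex.Re (conjc z * h) <= cmod (z + h) ^+ 2.
Proof. by rewrite sqr_cmodD lerD2r lerDl sqr_ge0. Qed.

Lemma cmodJ (R : realType) (z : R[i]) : cmod (conjc z) = cmod z.
Proof. by case: z => a b; rewrite /cmod /= sqrrN. Qed.

(** The five-point discrete Laplacian, without its factor 1 / h^2. *)
Definition cross_sum (R : realType) (f : R[i] -> R[i]) (z h : R[i]) : R[i] :=
  f (z + h) + f (z + 'i%C * h) + f (z - h) + f (z - 'i%C * h) - 4%:R * f z.

(* A weak form of harmonicity: the terms of order 1 and 2 cancel over the
   directions 1, i, -1, -i. *)
Lemma cross_sum_small (R : realType) (f f1 : R[i] -> R[i]) (z d2 : R[i]) (r : R) :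
  0 < r -> (forall w, cmod (w - z) < r -> cderiv f w (f1 w)) -> cderiv f1 z d2 ->
  forall e : R, 0 < e -> exists2 s : R, 0 < s &
    forall h : R, 0 <= h -> h < s -> cmod (cross_sum f z h%:C%C) <= e * h ^+ 2.
Proof.
move=> r0 hf hf1 e e0; have e4 : 0 < e / 4 by rewrite divr_gt0.
have [s s0 sP] := hf1 _ e4.
exists (Num.min r s) => [|h h0]; first by rewrite lt_min r0.
rewrite lt_min => /andP[hr hs].
have ii : ('i%C * 'i%C : R[i]) = -1 by rewrite -expr2 sqr_i.
pose S1 (t : R) : R[i] := f1 (z + t%:C%C * 1) + 'i%C * f1 (z + t%:C%C * 'i%C)
   + (-1) * f1 (z + t%:C%C * (-1)) + (- 'i%C) * f1 (z + t%:C%C * (- 'i%C)).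
pose S (t : R) : R[i] := f (z + t%:C%C * 1) + f (z + t%:C%C * 'i%C)
   + f (z + t%:C%C * (-1)) + f (z + t%:C%C * (- 'i%C)).
have c1 : @cmod R 1 = 1 by rewrite -(rmorph1 (real_complex R)) cmod_real normr1.
have dir (b : R[i]) (t : R) : cmod b = 1 -> 0 <= t <= h ->
    cmod (z + t%:C%C * b - z) = t.
  by move=> b1 tP; rewrite addrAC subrr add0r cmodM b1 mulr1 cmod_real ger0_norm; lra.
have dirs (b : R[i]) t : cmod b = 1 -> 0 <= t <= h ->
    rderiv (fun t => f (z + t%:C%C * b)) t (b * f1 (z + t%:C%C * b)).
  move=> b1 tP; apply: rderiv_line; apply: hf; rewrite dir//; lra.
have rD (K L : R -> R[i]) t k l : rderiv K t k -> rderiv L t l ->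
    rderiv (fun t => K t + L t) t (k + l).
  move=> hK hL q q0; have q2 : 0 < q / 2 by rewrite divr_gt0.
  have [a a0 aP] := hK _ q2; have [b b0 bP] := hL _ q2.
  exists (Num.min a b) => [|u]; first by rewrite lt_min a0.
  rewrite lt_min => /andP[/aP h1 /bP h2].
  set v := (u - t)%:C%C in h1 h2 *.
  have -> : K u + L u - (K t + L t) - (k + l) * v =
    (K u - K t - k * v) + (L u - L t - l * v) by ring.
  by apply: le_trans (cmod_le_add _ _) _; lra.
have := @rderiv_mean_value_le _ S S1 0 h (e * h) 0 h0; rewrite mul0r !subr0.
have -> : S h - S 0 = cross_sum f z h%:C%C.
  rewrite /S /cross_sum rmorph0 !mul0r !addr0 !mulr1 !mulrN mulr1.
  by rewrite [_ * 'i%C]mulrC; ring.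
have -> : e * h * h = e * h ^+ 2 by ring.
apply=> t tP.
  rewrite /S /S1; apply: (rD); last by apply: dirs; rewrite ?cmodN ?cmodi.
  apply: (rD); last by apply: dirs; rewrite ?cmodN.
  apply: (rD); last by apply: dirs; rewrite ?cmodi.
  by have := dirs 1 t c1 tP; rewrite mul1r.
rewrite subr0.
have est b : cmod b = 1 ->
   cmod (f1 (z + t%:C%C * b) - f1 z - d2 * (t%:C%C * b)) <= e / 4 * h.
  move=> b1; have := sP (z + t%:C%C * b); rewrite dir//.
  have -> : z + t%:C%C * b - z = t%:C%C * b by ring.
  move=> /(_ _) l; apply: le_trans (l _) _; first lra.
  by rewrite ler_pM2l//; lra.
have l1 := est 1 c1; have l2 := est 'i%C (@cmodi R).
have l3 := est (-1) (etrans (cmodN _) c1).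
have l4 := est (- 'i%C) (etrans (cmodN _) (@cmodi R)).
move: l1 l2 l3 l4; set a1 := f1 _ - _ - _; set a2 := f1 _ - _ - _.
set a3 := f1 _ - _ - _; set a4 := f1 _ - _ - _ => l1 l2 l3 l4.
(* The four directions have sum 0 and so do their squares: [f1 z] and [d2] drop out, leaving only
   the first-order remainders of [f1], each at most e / 4 * h. *)
have -> : S1 t = a1 + 'i%C * a2 - a3 - 'i%C * a4.
  rewrite /S1 /a1 /a2 /a3 /a4.
  transitivity (f1 (z + t%:C%C * 1) + 'i%C * f1 (z + t%:C%C * 'i%C)
   + (-1) * f1 (z + t%:C%C * (-1)) + (- 'i%C) * f1 (z + t%:C%C * (- 'i%C))
   - 2%:R * d2 * t%:C%C * (1 + 'i%C * 'i%C)); last by ring.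
  by rewrite ii subrr mulr0 subr0.
have := cmod_le_add (a1 + 'i%C * a2 - a3) (- ('i%C * a4)).
have := cmod_le_add (a1 + 'i%C * a2) (- a3).
have := cmod_le_add a1 ('i%C * a2).
by rewrite !cmodN !cmodM cmodi !mul1r; lra.
Qed.

Lemma sqr_continuous_eps (R : realType) (phi : R[i] -> R) (z : R[i]) :
  (forall e : R, 0 < e -> exists2 r : R, 0 < r &
     forall w, cmod (w - z) < r -> `|phi w - phi z| < e) ->
  forall e : R, 0 < e -> exists2 r : R, 0 < r &
     forall w, cmod (w - z) < r -> `|phi w ^+ 2 - phi z ^+ 2| < e.
Proof.
move=> hphi e e0; pose b := 2 * `|phi z| + 1.
have b0 : 0 < b by rewrite ltr_wpDl// mulr_ge0.
have d0 : 0 < Num.min 1 (e / b) by rewrite lt_min ltr01 divr_gt0.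
have [r r0 rP] := hphi _ d0; exists r => // w /rP.
rewrite lt_min ltr_pdivlMr// => /andP[h1 h2].
rewrite subr_sqr normrM; apply: le_lt_trans h2; rewrite ler_wpM2l//.
have -> : phi w + phi z = (phi w - phi z) + 2 * phi z by ring.
by apply: le_trans (ler_normD _ _) _; rewrite normrM /b [`|2|]ger0_norm//; lra.
Qed.

Lemma cmod_dist_dist (R : realType) (z w : R[i]) :
  `|cmod z - cmod w| <= cmod (z - w).
Proof.
rewrite ler_norml; have := cmod_le_add (z - w) w; rewrite subrK.
by have := cmod_le_add (w - z) z; rewrite subrK (cmod_distC w z); lra.
Qed.

Lemma ReD (R : realType) (z w : R[i]) :
  complex.Re (z + w) = complex.Re z + complex.Re w.
Proof. by case: z w => a b [c d]. Qed.

(* At an interior maximum z of |f|^2 + ep |z|^2, the average over z +- h, z +- ih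
   exceeds the value at z by about ep h^2, a contradiction. *)
Lemma max_principle_twice (R : realType) (f f1 : R[i] -> R[i]) (rho rho' M : R) :
  0 < rho -> rho < rho' -> 0 <= M ->
  (forall z, cmod z < rho' -> cderiv f z (f1 z)) ->
  (forall z, cmod z < rho' -> exists d, cderiv f1 z d) ->
  (forall z, cmod z = rho -> cmod (f z) <= M) ->
  forall z, cmod z <= rho -> cmod (f z) <= M.
Proof.
move=> rho0 rho1 M0 hf hf1 hM z0 z0r; rewrite leNgt; apply/negP => Mz0.
pose gap := cmod (f z0) ^+ 2 - M ^+ 2.
have gap0 : 0 < gap by rewrite subr_gt0 ltr_pXn2r// nnegrE ?(ltW (le_lt_trans M0 Mz0)).
pose k := 2 * rho ^+ 2; have k0 : 0 < k by rewrite mulr_gt0// exprn_gt0.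
(* On the circle |z| = rho the added term is gap / 2, too little to make up for the gap to |f z0|^2,
   so the maximum of [u] is interior. *)
pose ep := gap / k; have ep0 : 0 < ep by rewrite divr_gt0.
pose u z := cmod (f z) ^+ 2 + ep * cmod z ^+ 2.
have [|zs zsr umax] := @disc_max R u rho (ltW rho0).
  move=> z zr e e0; have e2 : 0 < e / 2 by rewrite divr_gt0.
  have hz := hf z (le_lt_trans zr rho1).
  have [|r1 r10 r1P] := @sqr_continuous_eps R (fun w => cmod (f w)) z _ _ e2.
    move=> q q0; have [r r0 rP] := cderiv_continuous hz q0.
    by exists r => // w /rP; apply: le_lt_trans (cmod_dist_dist _ _).
  have e3 : 0 < e / 2 / ep by rewrite divr_gt0.
  have [|r2 r20 r2P] := @sqr_continuous_eps R (fun w => cmod w) z _ _ e3.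
    move=> q q0; exists q => // w; apply: le_lt_trans (cmod_dist_dist _ _).
  exists (Num.min r1 r2) => [|w]; first by rewrite lt_min r10.
  rewrite lt_min => /andP[/r1P h1 /r2P]; rewrite ltr_pdivlMr// => h2.
  have -> : u w - u z = (cmod (f w) ^+ 2 - cmod (f z) ^+ 2) +
     ep * (cmod w ^+ 2 - cmod z ^+ 2) by rewrite /u; ring.
  apply: le_lt_trans (ler_normD _ _) _; rewrite normrM (gtr0_norm ep0); lra.
have zs_int : cmod zs < rho.
  rewrite lt_neqAle zsr andbT; apply/eqP => zsE.
  have := umax _ z0r; rewrite /u zsE leNgt => /negP; apply.
  have h1 : cmod (f zs) ^+ 2 <= M ^+ 2.
    by rewrite ler_pXn2r ?nnegrE ?cmod_ge0// hM.
  have h2 : ep * rho ^+ 2 = gap / 2.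
    by rewrite /ep /k; field; rewrite gt_eqF.
  have h3 : 0 <= ep * cmod z0 ^+ 2 by rewrite mulr_ge0 ?sqr_ge0// ltW.
  by move: gap0; rewrite /gap in h2 *; lra.
have zs1 := lt_trans zs_int rho1.
have [d2 hd2] := hf1 _ zs1.
have r0 : 0 < rho' - cmod zs by rewrite subr_gt0.
have hfl w : cmod (w - zs) < rho' - cmod zs -> cderiv f w (f1 w).
  move=> h; apply: hf; have := cmod_le_add (w - zs) zs; rewrite subrK; lra.
(* With this tolerance |Re (conj (f zs) * S)| < ep * h^2 for the cross sum [S] below, whereas the
   four inequalities [lower] add up to Re (conj (f zs) * S) <= - 2 * ep * h^2, their terms linear in
   [p] cancelling. *)
have ef0 : 0 < ep / (cmod (f zs) + 1).
  by rewrite divr_gt0// ltr_wpDl// cmod_ge0.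
have [s s0 sP] := cross_sum_small r0 hfl hd2 ef0.
pose h := Num.min s (rho - cmod zs) / 2.
have hmin0 : 0 < Num.min s (rho - cmod zs) by rewrite lt_min s0 subr_gt0.
have h0 : 0 < h by rewrite divr_gt0.
have [hs hr] : h < s /\ h < rho - cmod zs.
  by apply/andP; rewrite -lt_min /h; lra.
have := sP h (ltW h0) hs; rewrite /cross_sum.
have in_disc p : cmod p = h -> u (zs + p) <= u zs.
  move=> ph; apply: umax; have := cmod_le_add zs p; lra.
have lower p : cmod p = h -> 2 * complex.Re (conjc (f zs) * (f (zs + p) - f zs))
    + ep * (h ^+ 2 + 2 * complex.Re (conjc zs * p)) <= 0.
  move=> ph; have := in_disc p ph; rewrite /u.
  have := sqr_cmodD_ge (f zs) (f (zs + p) - f zs).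
  rewrite (addrC (f zs)) subrK.
  have := sqr_cmodD zs p; rewrite ph => ->; rewrite !mulrDr; lra.
have hh : cmod h%:C%C = h by rewrite cmod_real ger0_norm// ltW.
have ih : cmod ('i%C * h%:C%C) = h by rewrite cmodM cmodi mul1r.
have l1 := lower _ hh; have l2 := lower _ ih.
have l3 : _ := lower (- h%:C%C) (etrans (cmodN _) hh).
have l4 : _ := lower (- ('i%C * h%:C%C)) (etrans (cmodN _) ih).
set S := _ - 4%:R * _ => Sle.
have RS : complex.Re (conjc (f zs) * S) =
  complex.Re (conjc (f zs) * (f (zs + h%:C%C) - f zs)) +
  complex.Re (conjc (f zs) * (f (zs + 'i%C * h%:C%C) - f zs)) +
  complex.Re (conjc (f zs) * (f (zs - h%:C%C) - f zs)) +
  complex.Re (conjc (f zs) * (f (zs - 'i%C * h%:C%C) - f zs)).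
  by rewrite -!ReD /S; congr complex.Re; ring.
have R0 : complex.Re (conjc zs * h%:C%C) + complex.Re (conjc zs * ('i%C * h%:C%C)) +
   complex.Re (conjc zs * - h%:C%C) + complex.Re (conjc zs * - ('i%C * h%:C%C)) = 0.
  by rewrite -!ReD (_ : _ + _ = 0)//; ring.
have : `|complex.Re (conjc (f zs) * S)| < ep * h ^+ 2.
  apply: le_lt_trans (Re_le_cmod _) _; rewrite cmodM cmodJ.
  have c0 := cmod_ge0 (f zs).
  apply: le_lt_trans (ler_wpM2l c0 Sle) _; rewrite mulrA ltr_pM2r ?exprn_gt0//.
  rewrite mulrA ltr_pdivrMr; last lra.
  by rewrite mulrC mulrDr; lra.
rewrite ltr_norml => /andP[+ _]; rewrite RS.
have : 0 < ep * h ^+ 2 by rewrite mulr_gt0// exprn_gt0.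
have : ep * (complex.Re (conjc zs * h%:C%C) + complex.Re (conjc zs * ('i%C * h%:C%C)) +
   complex.Re (conjc zs * - h%:C%C) + complex.Re (conjc zs * - ('i%C * h%:C%C))) = 0.
  by rewrite R0 mulr0.
rewrite !(mulrDr ep) in l1 l2 l3 l4 *; lra.
Qed.

(* A primitive [G] of [g] is twice differentiable, hence so are its difference
   quotients; these are averages of [g], so they inherit the bound [M], and they
   converge to [g]. The bound is assumed on an annulus because of the averaging. *)
Lemma max_principle (R : realType) (g : R[i] -> R[i]) (rho M : R) :
  0 < rho -> 0 <= M ->
  (forall z, cmod z < 9 * rho -> exists d, cderiv g z d) ->
  (forall z, rho <= cmod z -> cmod z < 9 * rho -> cmod (g z) <= M) ->
  forall z, cmod z <= rho -> cmod (g z) <= M.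
Proof.
move=> rho0 M0 hg hM z zr.
(* Difference quotients with step h < rho on the disc of radius 2 rho need a primitive on 3 rho, and
   [primitive_exists] triples the radius again: this is the origin of the 9. *)
have [G hG] : exists G : R[i] -> R[i], forall z, cmod z < 3 * rho -> cderiv G z (g z).
  apply: primitive_exists; first lra.
  by move=> w wr; apply: hg; lra.
apply/ler_addgt0Pr => e e0.
have hGz := hG z ltac:(lra).
have [r r0 rP] := hGz _ e0.
pose h := Num.min r rho / 2.
have hm0 : 0 < Num.min r rho by rewrite lt_min r0.
have h0 : 0 < h by rewrite divr_gt0.
have [hr hrho] : h < r /\ h < rho by apply/andP; rewrite -lt_min /h; lra.
have hC0 : h%:C%C != 0 :> R[i] by rewrite -(rmorph0 (real_complex R)) (inj_eq (@complexI R)) gt_eqF.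
pose f w := h%:C%C^-1 * (G (h%:C%C + w * 1) - G w).
have shift w : h%:C%C + w * 1 = w + h%:C%C by ring.
have cmh : cmod h%:C%C = h by rewrite cmod_real gtr0_norm.
have near2 w : cmod (w + h%:C%C) <= cmod w + h by rewrite -{2}cmh cmod_le_add.
have hf w : cmod w < 2 * rho -> cderiv f w (h%:C%C^-1 * (g (h%:C%C + w * 1) - g w)).
  move=> wr; apply: cderivZ; apply: cderivB; last by apply: hG; lra.
  rewrite -[g _]mul1r; apply: cderiv_affine; apply: hG; rewrite shift.
  by have := near2 w; lra.
have hf1 w : cmod w < 2 * rho ->
    exists d, cderiv (fun w => h%:C%C^-1 * (g (h%:C%C + w * 1) - g w)) w d.
  move=> wr; have [|d1 hd1] := hg (h%:C%C + w * 1).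
    by rewrite shift; have := near2 w; lra.
  have [|d0 hd0] := hg w; first lra.
  by exists (h%:C%C^-1 * (1 * d1 - d0)); apply: cderivZ; apply: cderivB => //;
    exact: cderiv_affine.
(* A segment of length [h] starting on the circle of radius rho + h never comes closer to 0 than
   rho, so it stays where the bound [M] is known. *)
have fb w : cmod w = rho + h -> cmod (f w) <= M.
  move=> wE; rewrite /f cmodM cmodV cmh mulrC ler_pdivrMr// shift.
  have := @cderiv_mean_value_le _ G g w (w + h%:C%C) 0 M; rewrite mul0r !subr0.
  have -> : w + h%:C%C - w = h%:C%C by ring.
  have pt (s : R) : 0 <= s <= 1 -> rho <= cmod (w + s%:C%C * h%:C%C) <= rho + 2 * h.
    move=> sP; have := cmod_dist_dist (w + s%:C%C * h%:C%C) w.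
    have -> : w + s%:C%C * h%:C%C - w = s%:C%C * h%:C%C by ring.
    rewrite cmodM cmh cmod_real (ger0_norm (x := s)); last lra.
    by rewrite ler_norml wE; nra.
  rewrite cmh; apply=> s /pt sP; first by apply: hG; lra.
  by rewrite subr0; apply: hM; lra.
have := @max_principle_twice R f _ (rho + h) (2 * rho) M ltac:(lra) ltac:(lra)
  M0 hf hf1 fb z ltac:(lra).
have := rP (z + h%:C%C); have -> : z + h%:C%C - z = h%:C%C by ring.
rewrite cmh => /(_ hr) l1 l2.
have gE : g z = f z - h%:C%C^-1 * (G (z + h%:C%C) - G z - g z * h%:C%C).
  by rewrite /f shift; field.
rewrite gE; apply: le_trans (cmod_le_add _ _) (lerD l2 _).
by rewrite cmodN cmodM cmodV cmh ler_pdivrMl// [leRHS]mulrC.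
Qed.

(** * Schwarz lemma and identity theorem *)

Lemma expr_unbounded (R : realType) (t K : R) : 1 < t -> exists n, K < t ^+ n.
Proof.
move=> t1; have bern n : 1 + n%:R * (t - 1) <= t ^+ n.
  elim: n => [|n IH]; first by rewrite mul0r addr0 expr0.
  have n0 : 0 <= n%:R * (t - 1) * (t - 1) by rewrite !mulr_ge0 ?subr_ge0 ?(ltW t1).
  have := ler_wpM2r (ltW (lt_trans ltr01 t1)) IH.
  by rewrite exprSr -natr1; nra.
have t10 : 0 < t - 1 by rewrite subr_gt0.
exists (Num.truncn (`|K| / (t - 1))).+1.
have := truncnS_gt (`|K| / (t - 1)); rewrite ltr_pdivrMr// => h.
have := bern (Num.truncn (`|K| / (t - 1))).+1; have := ler_norm K; lra.
Qed.

Lemma le0_of_geometric (R : realType) (a M s : R) : 0 <= s -> s < 1 ->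
  (forall n, a <= M * s ^+ n) -> a <= 0.
Proof.
move=> s0 s1 h; rewrite leNgt; apply/negP => a0.
have [s00|sN0] := eqVneq s 0.
  by have := h 1%N; rewrite s00 expr1 mulr0; lra.
have sgt : 0 < s by rewrite lt_def sN0.
have [n] := @expr_unbounded R s^-1 (M / a) ltac:(by rewrite invf_gt1).
rewrite exprVn ltr_pdivrMr// mulrC ltr_pdivlMr ?exprn_gt0//.
by have := h n; lra.
Qed.

(** For a > 0 the hypothesis keeps the powers of a / (b q) below b / a, which a base larger than 1
    would exceed. *)
Lemma le_of_power_le (R : realType) (a b q : R) : 0 <= a -> 0 < b -> 0 < q ->
  (forall n, a ^+ n.+1 <= b ^+ n.+1 * q ^+ n) -> a <= b * q.
Proof.
move=> a0 b0 q0 h; rewrite leNgt; apply/negP => ha.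
have bq : 0 < b * q by rewrite mulr_gt0.
have a1 : 0 < a := lt_trans bq ha.
have [n] := @expr_unbounded R (a / (b * q)) (b / a) ltac:(by rewrite ltr_pdivlMr// mul1r).
have X0 : 0 < b ^+ n * q ^+ n by rewrite mulr_gt0 ?exprn_gt0.
rewrite expr_div_n exprMn ltr_pdivrMr// mulrAC ltr_pdivlMr//.
by have := h n; rewrite !exprS; lra.
Qed.

Lemma cderiv_divpow (R : realType) (g : R[i] -> R[i]) (z d : R[i]) n : z != 0 ->
  cderiv g z d -> exists d', cderiv (fun w => g w / w ^+ n) z d'.
Proof.
move=> z0 hg; have zn0 : z ^+ n != 0 by rewrite expf_neq0.
by eexists; exact: (cderivM hg (@cderivV _ (fun w => w ^+ n) _ _ zn0 (cderivX n (cderiv_id z)))).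
Qed.

(* The maximum principle applies to (g - g(0))^(n+1) / z^n, which is visibly
   differentiable at 0 (unlike (g - g(0)) / z); then n goes to infinity. *)
Lemma schwarz (R : realType) (g : R[i] -> R[i]) (rho M : R) : 0 < rho ->
  (forall z, cmod z < 9 * rho -> exists d, cderiv g z d) ->
  (forall z, cmod z < 9 * rho -> cmod (g z) <= M) ->
  forall z, cmod z < 9 * rho -> cmod (g z - g 0) <= 2 * M / rho * cmod z.
Proof.
move=> rho0 hg hM.
have rho9 : 0 < 9 * rho by rewrite mulr_gt0.
have g0M : cmod (g 0) <= M by apply: hM; rewrite cmod0.
have M0 : 0 <= M by apply: le_trans g0M; exact: cmod_ge0.
have [d0 hd0] := hg 0 ltac:(by rewrite cmod0).
have dM z : cmod z < 9 * rho -> cmod (g z - g 0) <= 2 * M.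
  move=> zr; apply: le_trans (cmod_le_add _ _) _; rewrite cmodN.
  by have := hM z zr; lra.
move=> z z9.
have [zr|rz] := leP (cmod z) rho; last first.
  apply: le_trans (dM z z9) _; rewrite -mulrA ler_peMr//; first lra.
  by rewrite mulrC ler_pdivlMr// mul1r ltW.
have [->|zN0] := eqVneq z 0; first by rewrite subrr !cmod0 mulr0.
have z0 := cmod_gt0 zN0.
have [M00|MN0] := eqVneq M 0.
  by have := dM z z9; rewrite M00 !mulr0 !mul0r.
have Mgt : 0 < M by rewrite lt_def MN0.
have -> : 2 * M / rho * cmod z = 2 * M * (cmod z / rho) by field; rewrite gt_eqF.
apply: le_of_power_le => [||//|n]; rewrite ?cmod_ge0 ?divr_gt0//; first lra.
pose F w := (g w - g 0) ^+ n.+1 / w ^+ n.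
have hF w : cmod w < 9 * rho -> exists d, cderiv F w d.
  move=> wr; have [->|wN0] := eqVneq w 0; last first.
    have [d hd] := hg w wr; apply: cderiv_divpow => //.
    by apply: cderivX; apply: cderivB; [exact: hd|exact: cderiv_cst].
  (* Away from 0, F x = x * q^(n+1), where [q] is the difference quotient of [g] at 0 and tends to
     [d0]. *)
  exists (d0 ^+ n.+1) => e e0.
  have [r1 r10 r1P] := cderiv_continuous (cderivX n.+1 (cderiv_id d0)) e0.
  have r12 : 0 < r1 / 2 by rewrite divr_gt0.
  have [r r0 rP] := hd0 _ r12; exists r => // x; rewrite subr0 => xr.
  have -> : F 0 = 0 by rewrite /F subrr expr0n mul0r.
  have [->|xN0] := eqVneq x 0; first by rewrite /F subrr expr0n !mul0r mulr0 !subr0 cmod0 mulr0.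
  pose q := (g x - g 0) / x.
  have -> : F x - 0 - d0 ^+ n.+1 * x = x * (q ^+ n.+1 - d0 ^+ n.+1).
    rewrite /F /q expr_div_n subr0 mulrBr [x * d0 ^+ _]mulrC; congr (_ - _).
    by rewrite [x ^+ n.+1]exprS; field; rewrite expf_neq0.
  rewrite cmodM mulrC ler_pM2r ?cmod_gt0//; apply: ltW; apply: r1P.
  have -> : q - d0 = (g x - g 0 - d0 * x) / x by rewrite /q; field.
  rewrite cmodM cmodV ltr_pdivrMr ?cmod_gt0//.
  have := rP x; rewrite subr0 => /(_ xr) /le_lt_trans; apply.
  by rewrite ltr_pM2r ?cmod_gt0//; lra.
have bF w : rho <= cmod w -> cmod w < 9 * rho -> cmod (F w) <= (2 * M) ^+ n.+1 / rho ^+ n.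
  move=> rw wr; rewrite /F cmodM cmodV !cmodX; apply: ler_pM.
  - by rewrite exprn_ge0// cmod_ge0.
  - by rewrite invr_ge0 exprn_ge0// cmod_ge0.
  - by rewrite lerXn2r ?nnegrE ?cmod_ge0 ?dM//; lra.
  - rewrite lef_pV2 ?posrE ?exprn_gt0 ?(lt_le_trans rho0)//.
    by rewrite lerXn2r ?nnegrE ?cmod_ge0//; lra.
have B0 : 0 <= (2 * M) ^+ n.+1 / rho ^+ n.
  by rewrite divr_ge0 ?exprn_ge0//; lra.
have := max_principle rho0 B0 hF bF zr.
rewrite /F cmodM cmodV !cmodX ler_pdivrMr ?exprn_gt0// => /le_trans; apply.
by rewrite expr_div_n -mulrA [X in _ * X]mulrC.
Qed.

(* Apply the maximum principle to g / z^n and let n go to infinity. *)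
Lemma identity_disc (R : realType) (g : R[i] -> R[i]) (rho M delta : R) :
  0 < rho -> 0 < delta ->
  (forall z, cmod z < 9 * rho -> exists d, cderiv g z d) ->
  (forall z, cmod z < 9 * rho -> cmod (g z) <= M) ->
  (forall z, cmod z < delta -> g z = 0) ->
  forall z, cmod z < rho -> g z = 0.
Proof.
move=> rho0 delta0 hg hM g0 z zr.
have M0 : 0 <= M.
  by apply: le_trans (cmod_ge0 (g 0)) (hM _ _); rewrite cmod0 mulr_gt0.
apply: cmod_eq0; apply/eqP; rewrite eq_le cmod_ge0 andbT.
have s0 : 0 <= cmod z / rho by rewrite divr_ge0 ?cmod_ge0 ?ltW.
have s1 : cmod z / rho < 1 by rewrite ltr_pdivrMr// mul1r.
apply: (le0_of_geometric s0 s1 (M := M)) => n.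
have [->|zN0] := eqVneq z 0; first by rewrite g0 cmod0// mulr_ge0// mul0r exprn_ge0.
pose F w := g w / w ^+ n.
have hF w : cmod w < 9 * rho -> exists d, cderiv F w d.
  move=> wr; have [->|wN0] := eqVneq w 0; last first.
    by have [d hd] := hg w wr; apply: cderiv_divpow hd.
  (* Near 0 the numerator vanishes, so [F] is 0 there, including at 0 itself. *)
  exists 0; apply: (cderiv_local delta0 _ (cderiv_cst 0 0)) => x.
  by rewrite subr0 => xd; rewrite /F g0// mul0r.
have bF w : rho <= cmod w -> cmod w < 9 * rho -> cmod (F w) <= M / rho ^+ n.
  move=> rw wr; rewrite /F cmodM cmodV !cmodX; apply: ler_pM.
  - by rewrite cmod_ge0.
  - by rewrite invr_ge0 exprn_ge0// cmod_ge0.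
  - exact: hM.
  - rewrite lef_pV2 ?posrE ?exprn_gt0 ?(lt_le_trans rho0)//.
    by rewrite lerXn2r ?nnegrE ?cmod_ge0//; lra.
have B0 : 0 <= M / rho ^+ n by rewrite divr_ge0 ?exprn_ge0//; lra.
have := max_principle rho0 B0 hF bF (ltW zr).
rewrite /F cmodM cmodV !cmodX ler_pdivrMr ?exprn_gt0 ?cmod_gt0// => /le_trans; apply.
by rewrite expr_div_n -mulrA [X in _ * X]mulrC.
Qed.

(** * A functional equation characterizing polynomials *)

Lemma cderiv_sum (R : realType) (I : Type) (s : seq I) (f : I -> R[i] -> R[i])
    (z : R[i]) (d : I -> R[i]) :
  (forall i, cderiv (f i) z (d i)) ->
  cderiv (fun w => \sum_(i <- s) f i w) z (\sum_(i <- s) d i).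
Proof.
move=> h; elim: s => [|i s IH].
  by rewrite big_nil; under eq_fun do rewrite big_nil; exact: cderiv_cst.
by rewrite big_cons; under eq_fun do rewrite big_cons; exact: cderivD.
Qed.

Lemma cderiv_const_disc (R : realType) (g : R[i] -> R[i]) (delta : R) :
  (forall u, cmod u < delta -> cderiv g u 0) ->
  forall u, cmod u < delta -> g u = g 0.
Proof.
move=> hg u ud.
have : cmod (g u - g 0 - 0 * (u - 0)) <= 0 * cmod (u - 0).
  apply: (@cderiv_mean_value_le R g (fun=> 0)) => s sP; last by rewrite subrr cmod0.
  rewrite add0r subr0; apply: hg; rewrite cmodM cmod_real ger0_norm; last lra.
  by apply: le_lt_trans ud; rewrite ler_piMl ?cmod_ge0//; lra.
rewrite !mul0r subr0 => h; apply/eqP; rewrite -subr_eq0; apply/eqP/cmod_eq0.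
by apply/eqP; rewrite eq_le cmod_ge0 andbT.
Qed.

Lemma antideriv_poly (F : numFieldType) (Q : {poly F}) :
  exists2 P : {poly F}, (size P <= (size Q).+1)%N & P^`() = Q.
Proof.
exists (\poly_(i < (size Q).+1) (if i is j.+1 then Q`_j / j.+1%:R else 0)).
  exact: size_poly.
apply/polyP => i; rewrite coef_deriv coef_poly ltnS.
case: ltnP => [_|/leq_sizeP /(_ _ (leqnn i)) ->]; last by rewrite mul0rn.
by rewrite -[LHS]mulr_natr divfK// pnatr_eq0.
Qed.

Lemma poly_of_cderiv_poly (R : realType) (g : R[i] -> R[i]) (Q : {poly R[i]})
    (delta : R) : 0 < delta ->
  (forall u, cmod u < delta -> cderiv g u Q.[u]) ->
  exists P : {poly R[i]}, [/\ (size P <= (size Q).+1)%N, P^`() = Q &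
    forall u, cmod u < delta -> g u = P.[u]].
Proof.
move=> delta0 hg; have [P sP PQ] := antideriv_poly Q.
exists (P + (g 0 - P.[0])%:P); split.
- apply: leq_trans (size_polyD _ _) _; rewrite geq_max sP size_polyC.
  by case: (_ != 0).
- by rewrite derivD derivC addr0.
- move=> u ud; rewrite hornerD hornerC; apply/eqP; rewrite addrC -subr_eq; apply/eqP.
  apply: (@cderiv_const_disc R (fun u => g u - P.[u]) delta) => // w wd.
  rewrite -(subrr Q.[w]); apply: cderivB; first exact: hg.
  by rewrite -PQ; exact: cderiv_horner.
Qed.

Lemma cderiv_shift (R : realType) (g : R[i] -> R[i]) (a z d : R[i]) :
  cderiv g (z + a) d -> cderiv (fun w => g (w + a)) z d.
Proof.
move=> hg; have := @cderiv_affine R g a 1 z d.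
rewrite mulr1 mul1r addrC => /(_ hg).
by congr cderiv; apply/funext => w; rewrite mulr1 addrC.
Qed.

(* Lagrange interpolation expresses the increment of [g] at [u] by the increments
   at fixed nodes, and the relation passes to the derivatives. *)
Lemma cderiv_limit_poly (R : realType) (g : R[i] -> R[i]) (delta s : R) n :
  0 < delta -> 0 < s ->
  (forall u, cmod u < delta -> exists d, cderiv g u d) ->
  (forall h, cmod h < s -> exists2 P : {poly R[i]}, (size P <= n.+1)%N &
     forall u, cmod u < delta -> g (u + h) - g u = P.[u]) ->
  exists2 Q : {poly R[i]}, (size Q <= n.+1)%N &
     forall u, cmod u < delta -> cderiv g u Q.[u].
Proof.
move=> delta0 s0 hg hP.
(* Interpolation nodes; the offset 2 keeps the first one strictly inside the disc. *)
pose x (i : nat) : R[i] := (delta / i.+2%:R)%:C%C.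
have xd i : cmod (x i) < delta.
  rewrite cmod_real gtr0_norm ?divr_gt0// ltr_pdivrMr//.
  by rewrite -[ltLHS]mulr1 ltr_pM2l// (ltr_nat R 1).
have xI : injective x.
  move=> i j /complexI /(mulfI (lt0r_neq0 delta0)) /invr_inj /eqP.
  by rewrite eqr_nat => /eqP [].
have /choice[d hd] : forall i, exists di, cderiv g (x i) di by move=> i; exact: hg.
pose L := @lagrange R[i] n.+1 x.
pose ell (i : 'I_n.+1) : {poly R[i]} := tnth L i.
exists (\sum_(i < n.+1) d i *: ell i).
  apply: leq_trans (size_sum _ _ _) _; apply/bigmax_leqP => i _.
  by apply: leq_trans (size_scale_leq _ _) _; rewrite size_lagrange_.
move=> u ud; have [du hdu] := hg u ud.
suff -> : (\sum_(i < n.+1) d i *: ell i).[u] = du by [].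
have e1 : cderiv (fun w => g (u + w)) 0 du.
  have := @cderiv_shift R g u 0 du; rewrite add0r => /(_ hdu).
  by congr cderiv; apply/funext => w; rewrite addrC.
have e2 : cderiv (fun w => g u + \sum_(i < n.+1) (ell i).[u] * (g (x i + w) - g (x i)))
    0 (\sum_(i < n.+1) (ell i).[u] * d i).
  rewrite -[\sum_(_ < _) _ * d _]add0r; apply: cderivD; first exact: cderiv_cst.
  apply: cderiv_sum => i; apply: cderivZ; rewrite -[d i]subr0; apply: cderivB.
    have := @cderiv_shift R g (x i) 0 (d i); rewrite add0r => /(_ (hd i)).
    by congr cderiv; apply/funext => w; rewrite addrC.
  exact: cderiv_cst.
have -> : (\sum_(i < n.+1) d i *: ell i).[u] = \sum_(i < n.+1) (ell i).[u] * d i.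
  by rewrite horner_sum; apply: eq_bigr => i _; rewrite hornerZ mulrC.
apply: cderiv_unique e2 _; apply: cderiv_local s0 _ e1 => w; rewrite subr0 => ws.
have [P sP PE] := hP w ws.
have -> : g (u + w) = g u + P.[u] by rewrite -PE// [RHS]addrC subrK.
congr (_ + _); rewrite {1}(lagrange_gen (ltn0Sn n) xI sP) horner_sum.
by apply: eq_bigr => i _; rewrite hornerM hornerC -PE// mulrC.
Qed.

(* Replacing (u, t) by (u + b_N h, t - h) and subtracting removes the last term,
   while f_0 becomes one of its increments. *)
Lemma functional_equation_poly (R : realType) N (b : nat -> R[i]) (delta : R) :
  0 < delta -> b 0%N = 0 -> (forall k, (0 < k <= N)%N -> b k != 0) ->
  exists delta' : R, [/\ 0 < delta', delta' <= delta &
    forall f : nat -> R[i] -> R[i],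
    (forall u, cmod u < delta -> exists d, cderiv (f 0%N) u d) ->
    (forall u t, cmod u < delta -> cmod t < delta ->
       \sum_(k < N.+1) f k (u + b k * t) = 0) ->
    exists2 P : {poly R[i]}, (size P <= N.+1)%N &
      forall u, cmod u < delta' -> f 0%N u = P.[u]].
Proof.
move=> + b0; elim: N delta => [|N IH] delta delta0 bN.
  exists delta; split=> // f _ hf; exists 0; first by rewrite size_poly0.
  move=> u ud; have := hf u 0 ud; rewrite cmod0 big_ord_recl big_ord0 addr0 mulr0 addr0.
  by rewrite horner0; exact.
have delta2 : 0 < delta / 2 by rewrite divr_gt0.
(* The radius is produced before the family [f] because the induction hypothesis is applied below to
   a family that depends on [h], and one disc has to serve for every [h]. *)
have [|delta' [d'0 d'd hd']] := IH _ delta2.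
  by move=> k /andP[k0 kN]; apply: bN; rewrite k0 leqW.
exists delta'; split=> //; first lra.
move=> f hf feq; set beta := b N.+1.
have beta0 : 0 < cmod beta by apply: cmod_gt0; apply: bN; rewrite /= leqnn.
(* The first bound keeps u + h' in the disc of radius [delta]; the second gives |h| < delta / 2 for
   h = h' / beta. *)
pose s := Num.min (delta / 2) (delta / 2 * cmod beta).
have s0 : 0 < s by rewrite lt_min delta2 mulr_gt0.
have [||Q sQ hQ] := @cderiv_limit_poly R (f 0%N) delta' s N d'0 s0; last first.
- have [P [sP _ PE]] := poly_of_cderiv_poly d'0 hQ.
  by exists P => //; apply: leq_trans sP _; rewrite ltnS.
- move=> h'; rewrite lt_min => /andP[h1 h2].
  pose h := h' / beta.
  have bN0 : beta != 0 by apply: contraTneq beta0 => ->; rewrite cmod0 ltxx.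
  have bh : beta * h = h' by rewrite mulrC divfK.
  have hd : cmod h < delta / 2 by rewrite cmodM cmodV ltr_pdivrMr.
  (* At k = 0 this is the increment of [f 0] by beta * h = h'; at k = N + 1 it would be 0, which is
     the elimination. *)
  have [||P sP PE] := hd' (fun k w => f k (w + (beta - b k) * h) - f k w).
  + move=> u ud; have [|d1 hd1] := hf (u + (beta - b 0%N) * h).
      have := cmod_le_add u ((beta - b 0%N) * h); rewrite b0 subr0 bh; lra.
    have [|d2 hd2] := hf u; first lra.
    by exists (d1 - d2); apply: cderivB => //; exact: cderiv_shift.
  + move=> u t ud td.
    have := cmod_le_add u h'; have := cmod_le_add t (- h); rewrite cmodN => l1 l2.
    have e1 : \sum_(k < N.+2) f k (u + b k * t) = 0 by apply: feq; lra.
    have e2 : \sum_(k < N.+2) f k (u + h' + b k * (t - h)) = 0 by apply: feq; lra.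
    rewrite big_ord_recr /= in e1; rewrite big_ord_recr /= in e2.
    transitivity (\sum_(k < N.+1) f k (u + h' + b k * (t - h)) -
       \sum_(k < N.+1) f k (u + b k * t)).
      rewrite -sumrB; apply: eq_bigr => k _; congr (f _ _ - _).
      by rewrite -bh; ring.
    have E : u + h' + b N.+1 * (t - h) = u + b N.+1 * t by rewrite -bh /beta; ring.
    rewrite E in e2; apply/eqP; rewrite subr_eq0; apply/eqP.
    by apply/(addIr (f N.+1 (u + b N.+1 * t))); rewrite e1 e2.
  exists P => // u ud; rewrite -PE// b0 subr0 bh//.
- by move=> u ud; apply: hf; lra.
Qed.

(** * Holomorphic maps in several variables *)

Definition vmod (R : realType) (n : nat) (x : Cspace R n) : R :=
  \big[Num.max/0]_(i < n) cmod (x ord0 i).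

Lemma vmod_leP (R : realType) (n : nat) (x : Cspace R n) (M : R) : 0 <= M ->
  vmod x <= M <-> forall i, cmod (x ord0 i) <= M.
Proof.
by move=> M0; split => [/bigmax_leP[_ h] i|h]; [exact: h|apply/bigmax_leP].
Qed.

Lemma vmod_ltP (R : realType) (n : nat) (x : Cspace R n) (M : R) : 0 < M ->
  vmod x < M <-> forall i, cmod (x ord0 i) < M.
Proof.
by move=> M0; split => [/bigmax_ltP[_ h] i|h]; [exact: h|apply/bigmax_ltP].
Qed.

Lemma cmod_le_vmod (R : realType) (n : nat) (x : Cspace R n) i :
  cmod (x ord0 i) <= vmod x.
Proof. exact: le_bigmax. Qed.

Lemma vmod_ge0 (R : realType) (n : nat) (x : Cspace R n) : 0 <= vmod x.
Proof. exact: bigmax_ge_id. Qed.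

Lemma vmod0 (R : realType) (n : nat) : vmod (0 : Cspace R n) = 0.
Proof.
by apply/eqP; rewrite eq_le vmod_ge0 andbT; apply/vmod_leP => // i; rewrite mxE cmod0.
Qed.

Lemma vmod_eq0 (R : realType) (n : nat) (x : Cspace R n) : vmod x = 0 -> x = 0.
Proof.
move=> x0; apply/rowP => i; rewrite mxE; apply: cmod_eq0; apply/eqP.
by rewrite eq_le cmod_ge0 andbT -x0 cmod_le_vmod.
Qed.

Lemma vmod_le_add (R : realType) (n : nat) (x y : Cspace R n) :
  vmod (x + y) <= vmod x + vmod y.
Proof.
apply/vmod_leP => [|i]; first by rewrite addr_ge0 ?vmod_ge0.
rewrite mxE; apply: le_trans (cmod_le_add _ _) _.
by apply: lerD; exact: cmod_le_vmod.
Qed.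

Lemma vmodN (R : realType) (n : nat) (x : Cspace R n) : vmod (- x) = vmod x.
Proof. by apply: eq_bigr => i _; rewrite mxE cmodN. Qed.

Lemma vmod_distC (R : realType) (n : nat) (x y : Cspace R n) :
  vmod (x - y) = vmod (y - x).
Proof. by rewrite -vmodN opprB. Qed.

Lemma vmodZ (R : realType) (n : nat) (c : Cplx R) (x : Cspace R n) :
  vmod (c *: x) <= cmod c * vmod x.
Proof.
apply/vmod_leP => [|i]; first by rewrite mulr_ge0 ?cmod_ge0 ?vmod_ge0.
by rewrite mxE cmodM ler_wpM2l ?cmod_ge0// cmod_le_vmod.
Qed.

Lemma vmod_dist_dist (R : realType) (n : nat) (x y : Cspace R n) :
  `|vmod x - vmod y| <= vmod (x - y).
Proof.
rewrite ler_norml; have := vmod_le_add (x - y) y; rewrite subrK.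
by have := vmod_le_add (y - x) x; rewrite subrK (vmod_distC y x); lra.
Qed.

Lemma near_vmodP (R : realType) (n : nat) (x : Cspace R n) (P : Cspace R n -> Prop) :
  (\forall y \near x, P y) <->
  exists2 r : R, 0 < r & forall y, vmod (y - x) < r -> P y.
Proof.
split=> [/nbhs_ballP[e /= e0 eP]|[r r0 rP]].
  have eE : e = (complex.Re e)%:C%C by rewrite RRe_real// gtr0_real.
  have e0' : 0 < complex.Re e by rewrite -ltcR -eE.
  exists (complex.Re e) => // y /(vmod_ltP _ e0') ye; apply: eP; split=> // i j.
  rewrite -ball_normE /= distrC normCE eE ltcR.
  by have := ye j; rewrite !mxE (ord1 i).
apply/nbhs_ballP; exists r%:C%C => /=; first by rewrite ltcR.
move=> y [_ yr]; apply: rP; apply/vmod_ltP => // i; rewrite !mxE.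
by have := yr ord0 i; rewrite -ball_normE /= distrC normCE ltcR.
Qed.

Lemma is_derive_coord (R : realType) (n : nat) (psi : Cplx R -> Cspace R n)
    (t : Cplx R) (v : Cspace R n) (i : 'I_n) : is_derive t (1 : Cplx R) psi v ->
  cderiv (fun w => psi w ord0 i) t (v ord0 i).
Proof.
move=> [dpsi vE]; apply/cderivP.
have key : (fun h : Cplx R => h^-1 *: (psi (h *: (1 : Cplx R) + t) ord0 i - psi t ord0 i))
    @ 0^' --> v ord0 i.
  have h : (fun h : Cplx R => h^-1 *: (psi (h *: (1 : Cplx R) + t) - psi t)) @ 0^' --> v.
    by rewrite -vE; exact: dpsi.
  have := @cvg_comp _ _ _ _ (fun M : Cspace R n => M ord0 i : Cplx R) _ _ _ h
    (@coord_continuous (Cplx R) 1 n ord0 i v).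
  rewrite (_ : _ \o _ = (fun h : Cplx R =>
    h^-1 *: (psi (h *: (1 : Cplx R) + t) ord0 i - psi t ord0 i)))//.
  by apply/funext => w; rewrite /= !mxE.
by split; [apply/cvg_ex; exists (v ord0 i)|exact/cvg_lim].
Qed.

Lemma cderiv_comp_coord (R : realType) (n n' : nat) (X : Cspace R n -> Cspace R n')
    (psi : Cplx R -> Cspace R n) (t : Cplx R) (i : 'I_n') :
  differentiable psi t -> differentiable X (psi t) ->
  exists d, cderiv (fun w => X (psi w) ord0 i) t d.
Proof.
move=> dpsi dX; have /derivable1_diffP/derivableP d1 := differentiable_comp dpsi dX.
by eexists; exact: (is_derive_coord i d1).
Qed.

Lemma differentiable_row (R : realType) (n : nat) (f : 'I_n -> Cplx R -> Cplx R)
    (t : Cplx R) : (forall i, exists d, cderiv (f i) t d) ->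
  differentiable (fun w : Cplx R => \row_i f i w : Cspace R n) t.
Proof.
move=> hf.
have -> : (fun w : Cplx R => \row_i f i w : Cspace R n) =
   \sum_(i < n) (fun w : Cplx R => f i w *: (delta_mx ord0 i : Cspace R n)).
  apply/funext => w; rewrite [LHS]row_sum_delta fct_sumE.
  by apply: eq_bigr => i _; rewrite mxE.
apply: differentiable_sum => i; apply: differentiableZl.
by apply/derivable1_diffP; have [d /cderivP []] := hf i.
Qed.

Lemma differentiable_vmod_continuous (R : realType) (n n' : nat)
    (X : Cspace R n -> Cspace R n') (x : Cspace R n) : differentiable X x ->
  forall e : R, 0 < e -> exists2 r : R, 0 < r &
    forall y, vmod (y - x) < r -> vmod (X y - X x) < e.
Proof.
move=> /differentiable_continuous cX e e0.
have : \forall y \near X x, vmod (y - X x) < e by apply/near_vmodP; exists e.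
by move=> /cX /near_vmodP.
Qed.

Lemma differentiable_curve_continuous (R : realType) (n : nat)
    (psi : Cplx R -> Cspace R n) (t : Cplx R) : differentiable psi t ->
  forall e : R, 0 < e -> exists2 r : R, 0 < r &
    forall w, cmod (w - t) < r -> vmod (psi w - psi t) < e.
Proof.
move=> /differentiable_continuous cX e e0.
have : \forall y \near psi t, vmod (y - psi t) < e by apply/near_vmodP; exists e.
by move=> /cX /near_cmodP.
Qed.

(** The Schwarz lemma, applied to each coordinate of [X] along the complex line through [x] and [y],
    gives the bound without any estimate of the differential. *)
Lemma lipschitz_ball (R : realType) (n n' : nat) (X : Cspace R n -> Cspace R n')
    (m : Cspace R n) (r M : R) : 0 < r ->
  (forall z, vmod (z - m) < r -> differentiable X z) ->
  (forall z, vmod (z - m) < r -> vmod (X z) <= M) ->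
  forall x y, vmod (x - m) < r / 4 -> vmod (y - m) < r / 4 ->
    vmod (X y - X x) <= 36 * M / r * vmod (y - x).
Proof.
move=> r0 dX bX x y xr yr.
have M0 : 0 <= M by apply: le_trans (vmod_ge0 (X m)) (bX _ _); rewrite subrr vmod0.
have xy : vmod (y - x) < r / 2.
  have -> : y - x = (y - m) - (x - m) by rewrite opprB addrA subrK.
  have := vmod_le_add (y - m) (- (x - m)); rewrite vmodN; lra.
have [/eqP|yxN0] := eqVneq (vmod (y - x)) 0.
  by move=> /eqP /vmod_eq0 /eqP; rewrite subr_eq0 => /eqP ->; rewrite !subrr !vmod0 mulr0.
have yx0 : 0 < vmod (y - x) by rewrite lt_def yxN0 vmod_ge0.
apply/vmod_leP => [|i]; first by rewrite mulr_ge0 ?divr_ge0 ?mulr_ge0// ltW.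
pose line (w : Cplx R) : Cspace R n := \row_j (x ord0 j + w * (y - x) ord0 j).
have lineE w : line w = x + w *: (y - x) by apply/rowP => j; rewrite !mxE.
(* For |w| < 9 rho the displacement along the line is below r / 2, so the line stays in the ball.
   The 36 of the statement is 2 * 18. *)
pose rho := r / (18 * vmod (y - x)).
have rho0 : 0 < rho by rewrite divr_gt0// mulr_gt0.
have rhoE : 9 * rho * vmod (y - x) = r / 2.
  by rewrite /rho; field; rewrite gt_eqF.
have line_in w : cmod w < 9 * rho -> vmod (line w - m) < r.
  move=> wr; rewrite lineE addrAC; have := vmod_le_add (x - m) (w *: (y - x)).
  have := vmodZ w (y - x).
  have : cmod w * vmod (y - x) < 9 * rho * vmod (y - x) by rewrite ltr_pM2r.
  by rewrite rhoE; lra.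
have := @schwarz R (fun w => X (line w) ord0 i) rho M rho0.
have c1 : @cmod R 1 = 1 by rewrite -(rmorph1 (real_complex R)) cmod_real normr1.
move=> /(_ _ _ 1); rewrite c1 mulr1.
have -> : line 1 = y by rewrite lineE scale1r addrC subrK.
have -> : line 0 = x by rewrite lineE scale0r addr0.
rewrite !mxE.
have -> : 2 * M / rho = 36 * M / r * vmod (y - x).
  by rewrite /rho; field; rewrite !gt_eqF.
apply.
- move=> z zr; apply: cderiv_comp_coord; last exact/dX/line_in.
  apply: differentiable_row => j; eexists.
  by apply: cderivD (cderiv_cst _ _) (cderivM (cderiv_id _) (cderiv_cst _ _)).
- by move=> z zr; apply: le_trans (cmod_le_vmod _ _) (bX _ (line_in _ zr)).
- by rewrite -(ltr_pM2r yx0) rhoE mul1r.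
Qed.

(** * Trajectories of a rigid chambar are polynomial *)

Lemma cderiv_dist0_le (R : realType) (g dg : R[i] -> R[i]) (delta M : R) :
  (forall t, cmod t < delta -> cderiv g t (dg t)) ->
  (forall t, cmod t < delta -> cmod (dg t) <= M) ->
  forall t, cmod t < delta -> cmod (g t - g 0) <= M * cmod t.
Proof.
move=> hg hM t td.
have seg (s : R) : 0 <= s <= 1 -> cmod (0 + s%:C%C * (t - 0)) < delta.
  move=> sP; rewrite add0r subr0 cmodM cmod_real ger0_norm; last lra.
  by apply: le_lt_trans td; rewrite ler_piMl ?cmod_ge0//; lra.
have := @cderiv_mean_value_le R g dg 0 t 0 M; rewrite !mul0r !subr0; apply=> s /seg sP.
  by have := hg _ sP; rewrite subr0.
by rewrite subr0; have := hM _ sP; rewrite subr0.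
Qed.

(** A contraction: as L * delta <= 1 / 2, each use of the mean value inequality from 0 halves the
    bound on phi - psi, starting from [K]. *)
Lemma ode_unique (R : realType) (n : nat) (Y : Cspace R n -> Cspace R n)
    (phi psi : Cplx R -> Cspace R n) (delta L K : R) :
  0 < delta -> 0 <= L -> L * delta <= 1 / 2 ->
  (forall t, cmod t < delta -> forall i,
     cderiv (fun w => phi w ord0 i) t (Y (phi t) ord0 i)) ->
  (forall t, cmod t < delta -> forall i,
     cderiv (fun w => psi w ord0 i) t (Y (psi t) ord0 i)) ->
  (forall t, cmod t < delta ->
     vmod (Y (phi t) - Y (psi t)) <= L * vmod (phi t - psi t)) ->
  (forall t, cmod t < delta -> vmod (phi t - psi t) <= K) ->
  phi 0 = psi 0 ->
  forall t, cmod t < delta -> phi t = psi t.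
Proof.
move=> delta0 L0 Ld dphi dpsi lip bK init.
have K0 : 0 <= K.
  by apply: le_trans (vmod_ge0 (phi 0 - psi 0)) (bK _ _); rewrite cmod0.
have iter j t : cmod t < delta -> vmod (phi t - psi t) <= K * (1 / 2) ^+ j.
  elim: j t => [|j IH] t td; first by rewrite expr0 mulr1 bK.
  have Kj : 0 <= K * (1 / 2) ^+ j by rewrite mulr_ge0 ?exprn_ge0//; lra.
  apply/vmod_leP => [|i].
    by rewrite mulr_ge0// exprn_ge0//; lra.
  have := @cderiv_dist0_le R (fun w => phi w ord0 i - psi w ord0 i)
    (fun w => Y (phi w) ord0 i - Y (psi w) ord0 i) delta (L * (K * (1 / 2) ^+ j)).
  rewrite init subrr => h; have := h _ _ t td; rewrite subr0 !mxE.
  move=> {}h; apply: le_trans (h _ _) _.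
  - by move=> w wd; apply: cderivB; [exact: dphi|exact: dpsi].
  - move=> w wd; have := cmod_le_vmod (Y (phi w) - Y (psi w)) i; rewrite !mxE.
    move=> /le_trans; apply; apply: le_trans (lip w wd) _.
    by rewrite ler_wpM2l// IH.
  - have : L * (K * (1 / 2) ^+ j) * cmod t <= L * (K * (1 / 2) ^+ j) * delta.
      by rewrite ler_wpM2l ?mulr_ge0// ltW.
    rewrite exprSr => /le_trans; apply.
    have := ler_wpM2l Kj Ld; lra.
move=> t td; apply/eqP; rewrite -subr_eq0; apply/eqP/vmod_eq0/eqP.
rewrite eq_le vmod_ge0 andbT.
by apply: (@le0_of_geometric _ _ K (1 / 2)); [lra|lra|move=> j; exact: iter].
Qed.

Lemma flow_near (R : realType) (n : nat) (U : set (Cspace R n))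
    (X : Cspace R n -> Cspace R n) (c : Cplx R) (m z : Cspace R n) (r : R)
    (phi : Cplx R -> Cspace R n) : vmod (z - m) < r ->
  is_flow_at U (fun x => c *: X x) z phi ->
  exists2 delta : R, 0 < delta & forall t, cmod t < delta ->
    vmod (phi t - m) < r /\
    forall i, cderiv (fun w => phi w ord0 i) t (c * X (phi t) ord0 i).
Proof.
move=> zr [phi0 /near_cmodP[d1 d10 d1P]].
have [|_ [dphi _]] := d1P 0; first by rewrite subrr cmod0.
have e0 : 0 < r - vmod (z - m) by rewrite subr_gt0.
have := differentiable_curve_continuous _ e0 => /(_ n phi 0).
case=> [|d2 d20 d2P]; first exact/derivable1_diffP.
exists (Num.min d1 d2) => [|t]; first by rewrite lt_min d10.
rewrite lt_min => /andP[t1 t2]; split.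
  have := d2P t; rewrite subr0 phi0 => /(_ t2).
  have -> : phi t - m = (phi t - z) + (z - m) by rewrite addrA subrK.
  have := vmod_le_add (phi t - z) (z - m); lra.
move=> i; have [|_ dt] := d1P t; first by rewrite subr0.
by have := is_derive_coord i dt; rewrite mxE.
Qed.

(* With g = X o phi along the trajectory phi of x, uniqueness of the flows turns
   the barycentric property at phi u into sum_k a_k g (u + a_k t) = 0 for small t,
   and the identity theorem makes the smallness of t uniform in u. *)
Lemma chambar_trajectory_poly (R : realType) (n p : nat) (U : set (Cspace R n))
    (X : Cspace R n -> Cspace R n) (a : 'I_p.+1 -> Cplx R) (m x : Cspace R n)
    (r L : R) :
  (forall k, a k != 0) -> injective a -> 0 <= L ->
  (forall z, vmod (z - m) < r -> differentiable X z) ->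
  (forall z, vmod (z - m) < r -> vmod (X z) <= 1) ->
  (forall y z, vmod (y - m) < r -> vmod (z - m) < r ->
     vmod (X z - X y) <= L * vmod (z - y)) ->
  (forall z, vmod (z - m) < r -> exists phi : 'I_p.+1 -> Cplx R -> Cspace R n,
     (forall k, is_flow_at U (fun x => a k *: X x) z (phi k)) /\
     \forall t \near (0 : Cplx R), \sum_(k < p.+1) a k *: X (phi k t) = 0) ->
  vmod (x - m) < r ->
  exists (P : 'I_n -> {poly R[i]}) (delta : R),
    [/\ 0 < delta, forall i, (size (P i) <= p.+2)%N,
        forall i, (P i).[0] = x ord0 i &
        forall t : Cplx R, cmod t < delta ->
          vmod ((\row_i (P i).[t] : Cspace R n) - m) < r /\
          forall i, X (\row_i (P i).[t]) ord0 i = (P i)^`().[t]].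
Proof.
move=> a0 aI L0 dX bX lipX chX xr.
have [phi_ [flow_ _]] := chX x xr.
have [d dpos dP] := flow_near xr (flow_ ord0).
pose a_0 := a ord0; have a00 : 0 < cmod a_0 by apply: cmod_gt0; exact: a0.
(* Rescaling time turns a trajectory of a_0 X into one of [X]. *)
pose phi (t : Cplx R) := phi_ ord0 (t * a_0^-1).
pose d0 := d * cmod a_0; have d00 : 0 < d0 by rewrite mulr_gt0.
have dom t : cmod t < d0 -> cmod (t * a_0^-1) < d.
  by move=> td; rewrite cmodM cmodV ltr_pdivrMr.
have phi_in t : cmod t < d0 -> vmod (phi t - m) < r by move=> /dom /dP [].
have dphi t : cmod t < d0 ->
    forall i, cderiv (fun w => phi w ord0 i) t (X (phi t) ord0 i).
  move=> /dom td i; have [_ /(_ i) h] := dP _ td.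
  have := @cderiv_affine R (fun w => phi_ ord0 w ord0 i) 0 a_0^-1 t.
  rewrite add0r => /(_ _ h); rewrite mulrA mulVf ?mul1r; last exact: a0.
  by congr cderiv; apply/funext => w; rewrite add0r.
have phi0 : phi 0 = x by rewrite /phi mul0r; case: (flow_ ord0).
have diffphi (t : Cplx R) : cmod t < d0 -> differentiable phi t.
  move=> td; have -> : phi = (fun w => \row_i phi w ord0 i).
    by apply/funext => w; apply/rowP => i; rewrite mxE.
  by apply: differentiable_row => i; eexists; exact: dphi.
pose g i (t : Cplx R) : R[i] := X (phi t) ord0 i.
have dg i (t : Cplx R) : cmod t < d0 -> exists d, cderiv (g i) t d.
  by move=> td; apply: cderiv_comp_coord; [exact: diffphi|exact/dX/phi_in].
have bg i t : cmod t < d0 -> cmod (g i t) <= 1.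
  by move=> td; apply: le_trans (cmod_le_vmod _ _) (bX _ (phi_in _ td)).
pose A := 1 + \sum_k cmod (a k).
have aA k : cmod (a k) <= A.
  rewrite /A (bigD1 k)//= addrCA lerDl addr_ge0// sumr_ge0// => j _.
  exact: cmod_ge0.
have A1 : 1 <= A by rewrite lerDl sumr_ge0// => j _; exact: cmod_ge0.
have A0 : 0 < A by lra.
have rel_near u : cmod u < d0 / 2 -> exists2 e : R, 0 < e &
    forall t, cmod t < e -> forall i, \sum_k a k * g i (u + a k * t) = 0.
  move=> ud; have ud0 : cmod u < d0 by lra.
  have [psi [flow rel]] := chX _ (phi_in u ud0).
  (* Both sides, as functions of [t], are trajectories of a_k X starting at [phi u]. *)
  suff same k : \forall t \near (0 : Cplx R), psi k t = phi (u + a k * t).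
    have : \forall t \near (0 : Cplx R), forall k, psi k t = phi (u + a k * t).
      exact: (@filter_forall (Cplx R) 'I_p.+1
        (fun k t => psi k t = phi (u + a k * t)) (nbhs (0 : Cplx R)) _ same).
    move=> /near_cmodP[e1 e10 e1P]; move: rel => /near_cmodP[e2 e20 e2P].
    exists (Num.min e1 e2) => [|t]; first by rewrite lt_min e10.
    rewrite lt_min => /andP[t1 t2] i.
    have := e2P t; rewrite subr0 => /(_ t2) /(congr1 (fun v : Cspace R n => v ord0 i)).
    rewrite summxE mxE => E; rewrite -[RHS]E; apply: eq_bigr => k _.
    by rewrite mxE e1P// subr0.
  have [e1 e10 e1P] := flow_near (phi_in u ud0) (flow k).
  pose L' := cmod (a k) * L.
  have L'0 : 0 <= L' by rewrite mulr_ge0 ?cmod_ge0.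
  (* In order: psi k solves its equation inside the ball, u + a_k t stays in the domain of [phi],
     and L' * e <= 1 / 2 as [ode_unique] requires. *)
  pose e := Num.min e1 (Num.min (d0 / 2 / A) (1 / (2 * (L' + 1)))).
  have e0 : 0 < e.
    by rewrite !lt_min e10 !divr_gt0//; lra.
  apply/near_cmodP; exists e => // t; rewrite subr0.
  have e_1 t' : cmod t' < e -> cmod t' < e1 by rewrite lt_min => /andP[].
  have e_2 t' : cmod t' < e -> cmod (u + a k * t') < d0.
    rewrite !lt_min => /andP[_ /andP[+ _]]; rewrite ltr_pdivlMr// => h.
    apply: le_lt_trans (cmod_le_add _ _) _; rewrite cmodM.
    have := ler_wpM2r (cmod_ge0 t') (aA k); lra.
  have e_3 : L' * e <= 1 / 2.
    have : e <= 1 / (2 * (L' + 1)) by rewrite !ge_min lexx !orbT.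
    rewrite ler_pdivlMr; last lra.
    nra.
  have scaleE z i : (a k *: X z) ord0 i = a k * X z ord0 i by rewrite mxE.
  apply: (@ode_unique R n (fun z => a k *: X z) _ (fun t => phi (u + a k * t))
    e L' (2 * r)) => //.
  - move=> t' /e_1 /e1P [_ h] i; have := h i.
    by rewrite /= scaleE.
  - move=> t' /e_2 h i; rewrite /= scaleE.
    have := @cderiv_affine R (fun w => phi w ord0 i) u (a k) t'.
    rewrite mulrC => /(_ _ (dphi _ h i)).
    by congr cderiv; apply/funext => w; rewrite mulrC.
  - move=> t' t'e; rewrite -scalerBr; apply: le_trans (vmodZ _ _) _.
    rewrite -mulrA ler_wpM2l ?cmod_ge0//.
    by apply: lipX; [exact/phi_in/e_2|have [] := e1P _ (e_1 _ t'e)].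
  - move=> t' t'e; have h1 := phi_in _ (e_2 _ t'e); have [h2 _] := e1P _ (e_1 _ t'e).
    have -> : psi k t' - phi (u + a k * t') = (psi k t' - m) - (phi (u + a k * t') - m).
      by rewrite opprB addrA subrK.
    apply: le_trans (vmod_le_add _ _) _; rewrite vmodN; lra.
  - by rewrite mulr0 addr0; case: (flow k).
(* For |t| < 9 rho the points u + a_k t stay in the domain of [phi]; [identity_disc] then yields the
   relation for |t| < rho, a radius that does not depend on [u]. *)
pose rho := d0 / (18 * A).
have rho0 : 0 < rho by rewrite divr_gt0// mulr_gt0.
have rhoE : 9 * rho * A = d0 / 2 by rewrite /rho; field; rewrite gt_eqF.
have shift_dom u t k : cmod u < d0 / 2 -> cmod t < 9 * rho -> cmod (u + a k * t) < d0.
  move=> ud td; apply: le_lt_trans (cmod_le_add _ _) _; rewrite cmodM.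
  have := ler_wpM2r (cmod_ge0 t) (aA k).
  have : A * cmod t < A * (9 * rho) by rewrite ltr_pM2l.
  by lra.
have rel u t i : cmod u < d0 / 2 -> cmod t < rho -> \sum_k a k * g i (u + a k * t) = 0.
  move=> ud; have [e e0 eP] := rel_near u ud.
  apply: (@identity_disc R (fun t => \sum_k a k * g i (u + a k * t)) rho A e) => //.
  - move=> z zr; have /choice[dk dkP] : forall k, exists dk, cderiv (g i) (u + z * a k) dk.
      by move=> k; apply: dg; rewrite mulrC; exact: shift_dom.
    exists (\sum_k a k * (a k * dk k)); apply: cderiv_sum => k; apply: cderivZ.
    have := cderiv_affine (dkP k).
    by congr cderiv; apply/funext => w; rewrite mulrC.
  - move=> z zr; apply: le_trans (cmod_le_sum _ _ _) _.
    apply: (@le_trans _ _ (\sum_k cmod (a k))); last by rewrite /A lerDr.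
    apply: ler_sum => k _; rewrite cmodM -[leRHS]mulr1 ler_wpM2l ?cmod_ge0//.
    exact/bg/shift_dom.
  - by move=> z ze; exact: eP.
pose delta := Num.min rho (d0 / (4 * A)).
have delta0 : 0 < delta by rewrite lt_min rho0 divr_gt0// mulr_gt0.
have delta_d0 : A * delta <= d0 / 4.
  have : delta <= d0 / (4 * A) by rewrite ge_min lexx orbT.
  by rewrite ler_pdivlMr ?mulr_gt0//; lra.
(* Putting u - a_0 t for [u] in the relation turns its first term into a_0 g(u) and the other shifts
   into (a_k - a_0) t, with nonzero coefficients as [a] is injective; [delta] leaves room for this
   substitution. *)
have [||delta' [d'0 d'd polyP]] :=
  @functional_equation_poly R p (fun k => a (inord k) - a_0) delta delta0.
- have -> : inord 0 = ord0 :> 'I_p.+1 by apply/val_inj; rewrite /= inordK.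
  by rewrite subrr.
- move=> k /andP[k0 kp]; rewrite subr_eq0; apply: contraTneq k0 => /aI.
  by move=> /(congr1 val); rewrite /= inordK ?ltnS// => ->.
have delta_le : delta <= d0 / 4.
  by apply: le_trans delta_d0; rewrite ler_peMl// ltW.
have gpoly i : exists2 Q : {poly R[i]}, (size Q <= p.+1)%N &
    forall u, cmod u < delta' -> a_0 * g i u = Q.[u].
  have [||Q sQ QE] := polyP (fun k w => a (inord k) * g i w).
  - move=> u ud; have [|du hdu] := dg i u; first lra.
    by eexists; apply: cderivZ; exact: hdu.
  - move=> u t ud td; have := rel (u - a_0 * t) t i.
    have := cmod_le_add u (- (a_0 * t)); rewrite cmodN cmodM => l1.
    have l2 : cmod a_0 * cmod t <= A * cmod t.
      by apply: ler_wpM2r; [exact: cmod_ge0|exact: aA].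
    have l3 : A * cmod t < A * delta by rewrite ltr_pM2l.
    have l4 : cmod t < rho by move: td; rewrite lt_min => /andP[].
    move=> /(_ ltac:(lra) l4) E; rewrite -[RHS]E; apply: eq_bigr => k _.
    by rewrite inord_val; congr (_ * g i _); ring.
  exists Q => // u ud; rewrite -QE//; congr (a _ * _).
  by apply/val_inj; rewrite /= inordK.
have /choice[P PP] : forall i, exists P : {poly R[i]}, [/\ (size P <= p.+2)%N,
    P.[0] = x ord0 i & forall u, cmod u < delta' ->
    phi u ord0 i = P.[u] /\ g i u = P^`().[u]].
  move=> i; have [Q sQ QE] := gpoly i.
  have gE u : cmod u < delta' -> g i u = (a_0^-1 *: Q).[u].
    by move=> ud; rewrite hornerZ -QE// mulKf//; exact: a0.
  have [|P [sP PQ PE]] := @poly_of_cderiv_poly R (fun u => phi u ord0 i) (a_0^-1 *: Q) delta' d'0.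
    by move=> u ud; rewrite -gE//; apply: dphi; lra.
  exists P; split.
  - by apply: leq_trans sP _; rewrite ltnS; exact: leq_trans (size_scale_leq _ _) sQ.
  - by rewrite -PE ?cmod0// phi0.
  - by move=> u ud; rewrite PQ -gE// PE.
exists P, delta'; split=> //; try by move=> i; case: (PP i).
move=> t td; have -> : \row_i (P i).[t] = phi t.
  by apply/rowP => i; rewrite mxE; case: (PP i) => _ _ /(_ t td) [].
split; first by apply: phi_in; lra.
by move=> i; case: (PP i) => _ _ /(_ t td) [].
Qed.

(** * Polynomial trajectories near an isolated zero *)

Lemma cmod_horner_le (R : realType) (p : {poly R[i]}) (s : R) : 0 <= s <= 1 ->
  cmod p.[s%:C%C] <= \sum_(j < size p) cmod p`_j.
Proof.
move=> s01; rewrite horner_coef; apply: le_trans (cmod_le_sum _ _ _) _.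
apply: ler_sum => j _; rewrite cmodM cmodX cmod_real ger0_norm; last lra.
by rewrite ler_piMr ?cmod_ge0// exprn_ile1//; lra.
Qed.

(* By Lagrange interpolation at nodes of [0, T]. *)
Lemma markov_bound (R : realType) (n : nat) : exists2 C : R, 0 < C &
  forall (P : {poly R[i]}) (T K : R), (size P <= n.+1)%N -> 0 < T ->
    (forall s : R, 0 <= s <= T -> cmod P.[s%:C%C] <= K) ->
    forall s : R, 0 <= s <= T -> cmod P^`().[s%:C%C] <= C * K / T.
Proof.
pose x (i : nat) : R[i] := (i.+1%:R^-1 : R)%:C%C.
have xI : injective x.
  by move=> i j /complexI /invr_inj /eqP; rewrite eqr_nat => /eqP [].
pose ell (i : 'I_n.+1) : {poly R[i]} := tnth (@lagrange R[i] n.+1 x) i.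
(* On [0, 1] the derivative of a Lagrange polynomial is bounded by the sum of the moduli of its
   coefficients. The nodes are fixed in (0, 1], so the constant depends on [n] alone; rescaling
   [0, T] to [0, 1] brings in the 1 / T. *)
pose C0 : R := \sum_(i < n.+1) \sum_(j < size (ell i)^`()) cmod (ell i)^`()`_j.
have C00 : 0 <= C0 by rewrite !sumr_ge0// => i _; rewrite sumr_ge0// => j _; exact: cmod_ge0.
exists (C0 + 1); first lra.
move=> P T K sP T0 hK s sT.
have K0 : 0 <= K by apply: le_trans (cmod_ge0 _) (hK 0 _); lra.
pose q : {poly R[i]} := T%:C%C *: 'X.
pose Q := P \Po q.
have sQ : (size Q <= n.+1)%N.
  apply: leq_trans (size_comp_poly_leq _ _) _; rewrite ltnS.
  have sq : ((size q).-1 <= 1)%N.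
    by rewrite -subn1 leq_subLR; apply: leq_trans (size_scale_leq _ _) _; rewrite size_polyX.
  apply: leq_trans (leq_mul (leqnn _) sq) _; rewrite muln1.
  by rewrite -subn1 leq_subLR.
have QE (y : R) : Q.[y%:C%C] = P.[(T * y)%:C%C].
  by rewrite horner_comp hornerZ hornerX -rmorphM.
have dQE (y : R) : Q^`().[y%:C%C] = P^`().[(T * y)%:C%C] * T%:C%C.
  rewrite deriv_comp hornerM horner_comp derivZ derivX !hornerZ hornerX hornerC mulr1.
  by rewrite -rmorphM.
have y01 : 0 <= s / T <= 1 by rewrite ler_pdivrMr// mul1r divr_ge0//; lra.
have := dQE (s / T); have -> : T * (s / T) = s by field; rewrite gt_eqF.
move=> /(congr1 (@cmod R)); rewrite cmodM cmod_real (gtr0_norm T0) => E.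
rewrite ler_pdivlMr// -E {1}(lagrange_gen (ltn0Sn n) xI sQ) raddf_sum horner_sum.
apply: le_trans (cmod_le_sum _ _ _) _.
apply: (@le_trans _ _ (C0 * K)); last by rewrite ler_wpM2r//; lra.
rewrite /C0 mulr_suml; apply: ler_sum => i _.
rewrite /= derivM derivC mul0r add0r hornerM hornerC cmodM mulrC.
apply: ler_pM; rewrite ?cmod_ge0 ?cmod_horner_le//.
rewrite QE; apply: hK.
have i1 : (i.+1%:R^-1 : R) <= 1 by rewrite invf_le1 ?ler1n ?ltr0n.
have i0 : 0 <= (i.+1%:R^-1 : R) by rewrite invr_ge0 ler0n.
by rewrite mulr_ge0 ?(ltW T0)//= ler_piMr// ltW.
Qed.

(** [T] is the infimum of the times up to [t0] at which eps <= f; continuity excludes both f T < eps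
    and f T > eps. *)
Lemma first_hit (R : realType) (f : R -> R) (t0 eps : R) : 0 <= t0 ->
  (forall s, 0 <= s <= t0 -> forall e : R, 0 < e -> exists2 r : R, 0 < r &
     forall t, `|t - s| < r -> `|f t - f s| < e) ->
  f 0 < eps -> eps <= f t0 ->
  exists T, [/\ 0 < T, f T = eps & forall s, 0 <= s <= T -> f s <= eps].
Proof.
move=> t00 cf f0 ft0.
pose S := [set t : R | [/\ 0 <= t, t <= t0 & eps <= f t]].
have hS : has_inf S by split; [exists t0; split|exists 0 => t []].
have T0 : 0 <= inf S by apply: lb_le_inf; [exists t0; split|move=> t []].
have Tt0 : inf S <= t0 by apply: ge_inf; [case: hS|split].
have below s : 0 <= s -> s < inf S -> f s < eps.
  move=> s0 sT; rewrite ltNge; apply/negP => fs.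
  suff : inf S <= s by rewrite leNgt sT.
  by apply: ge_inf; [case: hS|split => //; lra].
have Tin : 0 <= inf S <= t0 by rewrite T0.
have geT : eps <= f (inf S).
  rewrite leNgt; apply/negP => fT.
  have e0 : 0 < eps - f (inf S) by rewrite subr_gt0.
  have [r r0 rP] := cf _ Tin _ e0.
  have [t [t1 t2 t3] tr] := inf_adherent r0 hS.
  have tT : inf S <= t by apply: ge_inf; [case: hS|split].
  have := rP t; rewrite ger0_norm; last lra.
  by move=> /(_ ltac:(lra)); rewrite ltr_norml; lra.
have Tpos : 0 < inf S.
  by rewrite lt_def T0 andbT; apply/eqP => T00; move: geT; rewrite T00; lra.
have fT : f (inf S) = eps.
  apply/eqP; rewrite eq_le geT andbT leNgt; apply/negP => fT.
  have e0 : 0 < f (inf S) - eps by rewrite subr_gt0.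
  have [r r0 rP] := cf _ Tin _ e0.
  pose s := Num.max 0 (inf S - r / 2).
  have s0 : 0 <= s by rewrite le_max lexx.
  have s1 : inf S - r / 2 <= s by rewrite le_max lexx orbT.
  have sT : s < inf S by rewrite gt_max Tpos; lra.
  have := below s s0 sT; have := rP s; rewrite distrC ger0_norm; last lra.
  by move=> /(_ ltac:(lra)); rewrite ltr_norml; lra.
exists (inf S); split=> // s /andP[s0]; rewrite le_eqVlt => /predU1P[->|sT].
  by rewrite fT.
exact/ltW/below.
Qed.

(** Connectedness of [0, T]. The hypothesis says in one clause that [Z] is open and closed: near
    each [s], a single point of [Z] brings in all the others. *)
Lemma segment_clopen (R : realType) (Z : R -> Prop) (T : R) : 0 <= T -> Z 0 ->
  (forall s, 0 <= s <= T -> exists2 r : R, 0 < r &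
    forall t u, 0 <= t <= T -> 0 <= u <= T -> `|t - s| < r -> `|u - s| < r -> Z t -> Z u) ->
  forall s, 0 <= s <= T -> Z s.
Proof.
move=> T0 Z0 hZ.
pose S := [set s : R | 0 <= s <= T /\ forall t, 0 <= t <= s -> Z t].
have S0 : S 0.
  split; first by rewrite lexx.
  by move=> t; rewrite -eq_le => /eqP <-.
have hS : has_sup S by split; [exists 0|exists T => s [/andP[_ sT] _]].
have T1 : 0 <= sup S by apply: ub_le_sup => //; case: hS.
have T2 : sup S <= T by apply: ge_sup; [exists 0|move=> s [/andP[_ sT] _]].
have Tin : 0 <= sup S <= T by rewrite T1.
have [r r0 rP] := hZ _ Tin.
have [s [sT Zs] sr] := sup_adherent r0 hS.
have ss : s <= sup S by apply: ub_le_sup; [by case: hS|by split].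
have all u : 0 <= u <= T -> u < sup S + r -> Z u.
  move=> uT ur; have [us|su] := leP u s; first by apply: Zs; lra.
  apply: (rP s u) => //; [|rewrite ltr_norml; lra|apply: Zs; lra].
  by rewrite ltr_norml; lra.
have supT : sup S = T.
  apply/eqP; rewrite eq_le T2 /= leNgt; apply/negP => lt.
  pose v := Num.min T (sup S + r / 2).
  have v1 : v <= T by rewrite ge_min lexx.
  have v2 : v <= sup S + r / 2 by rewrite ge_min lexx orbT.
  have v3 : sup S < v by rewrite lt_min lt; lra.
  suff : v <= sup S by rewrite leNgt v3.
  apply: ub_le_sup; first by case: hS.
  by split; [lra|move=> t tv; apply: all; lra].
by move=> u uT; apply: all => //; rewrite supT; lra.
Qed.

Lemma vmod_continuous (R : realType) (n : nat) :
  continuous (fun z : Cspace R n => vmod z : R).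
Proof.
move=> z; apply/(@cvgrPdist_lt R R^o _ (nbhs (z : Cspace R n))) => e e0.
apply/near_vmodP; exists e => // w wz; apply: le_lt_trans wz.
by rewrite distrC; exact: vmod_dist_dist.
Qed.

Lemma compact_sphere (R : realType) (n : nat) (m : Cspace R n) (eps : R) :
  compact [set z : Cspace R n | vmod (z - m) = eps].
Proof.
have cc : compact [set v : Cspace R n |
    forall i, [set w : Cplx R | cmod (w - m ord0 i) <= eps] (v ord0 i)].
  apply: (@rV_compact (Cplx R) n (fun i => [set w : Cplx R | cmod (w - m ord0 i) <= eps])) => i.
  have -> : [set w : Cplx R | cmod (w - m ord0 i) <= eps] =
      (fun w : Cplx R => w + m ord0 i) @` [set w : Cplx R | cmod w <= eps].
    apply/seteqP; split=> [w /= wE|_ [w /= wE <-]]; last by rewrite addrK.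
    by exists (w - m ord0 i) => //; rewrite subrK.
  apply: continuous_compact; last exact: compact_disc.
  apply: continuous_subspaceT => w.
  have /cderivP [/derivable1_diffP dw _] :=
    cderivD (cderiv_id w) (cderiv_cst (m ord0 i) w).
  exact: differentiable_continuous dw.
apply: subclosed_compact cc _.
  pose f (z : Cspace R n) : R := vmod (z - m).
  rewrite -[X in closed X]/(f @^-1` [set x : R | x = eps]).
  apply: closed_comp => [z _|]; last exact: closed_eq.
  apply/(@cvgrPdist_lt R R^o _ (nbhs (z : Cspace R n))) => e e0.
  apply/near_vmodP; exists e => // w; rewrite vmod_distC; apply: le_lt_trans.
  have -> : z - w = (z - m) - (w - m) by rewrite opprB addrA subrK.
  exact: vmod_dist_dist.
move=> z /= zE i; rewrite /= -zE; have := cmod_le_vmod (z - m) i.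
by rewrite !mxE.
Qed.

Lemma sphere_min (R : realType) (n n' : nat) (X : Cspace R n -> Cspace R n')
    (m : Cspace R n) (eps : R) : (0 < n)%N -> 0 < eps ->
  (forall z, vmod (z - m) = eps -> differentiable X z) ->
  (forall z, vmod (z - m) = eps -> X z <> 0) ->
  exists2 c : R, 0 < c & forall z, vmod (z - m) = eps -> c <= vmod (X z).
Proof.
move=> n0 eps0 dX X0.
have ne : [set z : Cspace R n | vmod (z - m) = eps] !=set0.
  exists (m + const_mx eps%:C%C); rewrite /= addrAC subrr add0r.
  apply/eqP; rewrite eq_le; apply/andP; split.
    by apply/vmod_leP => [|i]; rewrite ?mxE ?cmod_real ?gtr0_norm// ltW.
  have := cmod_le_vmod (const_mx eps%:C%C : Cspace R n) (Ordinal n0).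
  by rewrite mxE cmod_real gtr0_norm.
have := @compact_EVT_min _ R (fun z : Cspace R n => vmod (X z)) _ ne
  (@compact_sphere R n m eps).
case=> [|z]; last first.
  rewrite inE /= => zE h; exists (vmod (X z)).
    by rewrite lt_def vmod_ge0 andbT; apply/eqP => /vmod_eq0; exact: X0.
  by move=> w wE; apply: h; rewrite inE.
apply: continuous_in_subspaceT => z; rewrite inE /= => /dX /differentiable_continuous dXz.
exact: (continuous_comp dXz (@vmod_continuous R n' (X z))).
Qed.

Definition poly_path (R : realType) (n : nat) (P : 'I_n -> {poly R[i]})
  (t : Cplx R) : Cspace R n := \row_i (P i).[t].

Lemma differentiable_poly_path (R : realType) (n : nat) (P : 'I_n -> {poly R[i]})
  (t : Cplx R) : differentiable (poly_path P) t.
Proof.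
by apply: differentiable_row => i; eexists; exact: cderiv_horner.
Qed.

(** The differential equation, known only near time 0, is continued analytically along [0, T] as
    long as the polynomial path stays in the ball. *)
Lemma poly_trajectory_extends (R : realType) (n : nat)
    (X : Cspace R n -> Cspace R n) (m : Cspace R n) (r delta T : R)
    (P : 'I_n -> {poly R[i]}) : 0 < delta -> 0 <= T ->
  (forall z, vmod (z - m) < r -> differentiable X z) ->
  (forall z, vmod (z - m) < r -> vmod (X z) <= 1) ->
  (forall t, cmod t < delta -> forall i, X (poly_path P t) ord0 i = (P i)^`().[t]) ->
  (forall s, 0 <= s <= T -> vmod (poly_path P s%:C%C - m) < r) ->
  forall s, 0 <= s <= T ->
    forall i, X (poly_path P s%:C%C) ord0 i = (P i)^`().[s%:C%C].
Proof.
move=> delta0 T0 dX bX loc inB s sT i.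
pose E (z : Cplx R) := X (poly_path P z) ord0 i - (P i)^`().[z].
(* Vanishing on a complex disc around [s], not just at [s]: this is what [identity_disc] starts
   from. *)
pose Z (s : R) := exists2 eta : R, 0 < eta & forall z, cmod (z - s%:C%C) < eta -> E z = 0.
suff [eta eta0 etaP] : Z s.
  by apply/eqP; rewrite -subr_eq0; apply/eqP/etaP; rewrite subrr cmod0.
apply: (segment_clopen T0 _ _ sT).
  exists delta => // z; rewrite rmorph0 subr0 => zd.
  by rewrite /E loc// subrr.
move=> {sT}s sT.
have e0 : 0 < r - vmod (poly_path P s%:C%C - m) by rewrite subr_gt0 inB.
have [R1 R10 R1P] := differentiable_curve_continuous (differentiable_poly_path P s%:C%C) e0.
have [R2 R20 R2P] := cderiv_continuous (cderiv_horner (P i)^`() s%:C%C) ltr01.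
pose R0 := Num.min R1 R2.
have R00 : 0 < R0 by rewrite lt_min R10.
have in1 z : cmod (z - s%:C%C) < R0 -> vmod (poly_path P z - m) < r.
  rewrite lt_min => /andP[/R1P h _].
  have -> : poly_path P z - m = (poly_path P z - poly_path P s%:C%C) +
    (poly_path P s%:C%C - m) by rewrite addrA subrK.
  by apply: le_lt_trans (vmod_le_add _ _) _; lra.
pose M := 2 + cmod (P i)^`().[s%:C%C].
have bE z : cmod (z - s%:C%C) < R0 -> cmod (E z) <= M.
  move=> zR; apply: le_trans (cmod_le_add _ _) _; rewrite cmodN.
  have := le_trans (cmod_le_vmod _ i) (bX _ (in1 z zR)).
  move: zR; rewrite lt_min => /andP[_ /R2P].
  have := cmod_le_add ((P i)^`().[z] - (P i)^`().[s%:C%C]) (P i)^`().[s%:C%C].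
  by rewrite subrK /M; lra.
have dE (z : Cplx R) : cmod (z - s%:C%C) < R0 -> exists d, cderiv E z d.
  move=> zR; have [d hd] : exists d, cderiv (fun w => X (poly_path P w) ord0 i) z d.
    by apply: cderiv_comp_coord; [exact: differentiable_poly_path|exact/dX/in1].
  by eexists; apply: cderivB; [exact: hd|exact: cderiv_horner].
(* When |t - s| < rho / 2, the disc of radius 9 rho = R0 / 2 about [t] stays within [R0] of [s],
   where [E] is differentiable and bounded. *)
pose rho := R0 / 18.
have rho0 : 0 < rho by rewrite divr_gt0.
exists (rho / 2); first by rewrite divr_gt0.
move=> t u _ _ ts us [eta eta0 etaP].
have ut : `|u - t| < rho.
  have -> : u - t = (u - s) - (t - s) by ring.
  by apply: le_lt_trans (ler_normB _ _) _; lra.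
exists (rho - `|u - t|) => [|z zu]; first by rewrite subr_gt0.
have -> : E z = E ((z - t%:C%C) + t%:C%C) by rewrite subrK.
have in2 w : cmod w < 9 * rho -> cmod (w + t%:C%C - s%:C%C) < R0.
  move=> wr; have -> : w + t%:C%C - s%:C%C = w + (t - s)%:C%C by rewrite rmorphB /=; ring.
  by apply: le_lt_trans (cmod_le_add _ _) _; rewrite cmod_real; rewrite /rho in wr ts; lra.
apply: (@identity_disc R (fun w => E (w + t%:C%C)) rho M eta) => //.
- move=> w /in2 /dE [d hd]; exists d; exact: cderiv_shift.
- by move=> w /in2 /bE.
- by move=> w wd; apply: etaP; rewrite addrK.
- have -> : z - t%:C%C = (z - u%:C%C) + (u - t)%:C%C by rewrite rmorphB /=; ring.
  by apply: le_lt_trans (cmod_le_add _ _) _; rewrite cmod_real; lra.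
Qed.

(** A discrete form of Gronwall's inequality: in a time 1 / (2 L) the distance to [m] at most
    doubles. *)
Lemma poly_path_growth (R : realType) (n : nat) (m : Cspace R n)
    (P : 'I_n -> {poly R[i]}) (L T K : R) : 0 < L ->
  (forall s, 0 <= s <= T -> forall i,
     cmod (P i)^`().[s%:C%C] <= L * vmod (poly_path P s%:C%C - m)) ->
  (forall s, 0 <= s <= T -> vmod (poly_path P s%:C%C - m) <= K) ->
  forall j s, 0 <= s <= T -> s <= j%:R / (2 * L) ->
    vmod (poly_path P s%:C%C - m) <= 2 ^+ j * vmod (poly_path P 0 - m).
Proof.
move=> L0 dP bP; elim=> [|j IH] s sT.
  rewrite mul0r => s0; have -> : s = 0 by lra.
  by rewrite expr0 mul1r rmorph0.
pose a : R := j%:R / (2 * L).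
have a0 : 0 <= a by rewrite divr_ge0// mulr_ge0// ltW.
have v0 := vmod_ge0 (poly_path P 0 - m).
have [sa _|as_ sj] := leP s a.
  apply: le_trans (IH s sT sa) _; rewrite exprS -mulrA.
  have : 0 <= 2 ^+ j * vmod (poly_path P 0 - m) by rewrite mulr_ge0 ?exprn_ge0.
  by lra.
have aT : 0 <= a <= T by rewrite a0; lra.
pose va := vmod (poly_path P a%:C%C - m).
have va0 : 0 <= va := vmod_ge0 _.
have vaE : va <= 2 ^+ j * vmod (poly_path P 0 - m) by exact: IH.
have K0 : 0 <= K := le_trans (vmod_ge0 _) (bP _ aT).
have sa : L * (s - a) <= 1 / 2.
  have : s - a <= 1 / (2 * L).
    have -> : 1 / (2 * L) = j.+1%:R / (2 * L) - a.
      by rewrite /a -mulrBl -(natrB _ (leqnSn j)) subSnn.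
    by lra.
  by rewrite ler_pdivlMr ?mulr_gt0//; lra.
(* The mean value inequality improves a bound B on [a, s] to va + B / 2; iterated from 2 va + K,
   this tends to the fixed point 2 va. *)
have iter k u : a <= u <= s -> vmod (poly_path P u%:C%C - m) <= 2 * va + K * (1 / 2) ^+ k.
  elim: k u => [|k IHk] u au.
    rewrite expr0 mulr1; have := bP u ltac:(lra); lra.
  set B := 2 * va + K * (1 / 2) ^+ k in IHk.
  have Kk : 0 <= K * (1 / 2) ^+ k by rewrite mulr_ge0// exprn_ge0//; lra.
  have B0 : 0 <= B by rewrite /B; lra.
  have BE : va + 1 / 2 * B = 2 * va + K * (1 / 2) ^+ k.+1 by rewrite /B exprS; lra.
  rewrite -BE; apply/vmod_leP => [|i]; first lra.
  have au' : a <= u by case/andP: au.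
  have := @rderiv_mean_value_le R (fun t => (P i).[t%:C%C])
    (fun t => (P i)^`().[t%:C%C]) a u (L * B) 0 au'.
  rewrite mul0r subr0 => mv.
  have {}mv : cmod ((P i).[u%:C%C] - (P i).[a%:C%C]) <= L * B * (u - a).
    apply: mv => t tP; first exact/rderiv_cderiv/cderiv_horner.
    rewrite subr0; apply: le_trans (dP t _ i) _; first lra.
    by rewrite ler_pM2l//; apply: IHk; lra.
  have -> : (poly_path P u%:C%C - m) ord0 i =
    (P i).[u%:C%C] - (P i).[a%:C%C] + (poly_path P a%:C%C - m) ord0 i.
    by rewrite !mxE; ring.
  apply: le_trans (cmod_le_add _ _) _.
  have := cmod_le_vmod (poly_path P a%:C%C - m) i; rewrite -/va.
  have : L * B * (u - a) <= B * (1 / 2).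
    rewrite mulrAC [leLHS]mulrC; apply: ler_wpM2l => //; apply: le_trans sa.
    by rewrite ler_pM2l//; lra.
  by lra.
have vs : vmod (poly_path P s%:C%C - m) - 2 * va <= 0.
  apply: (@le0_of_geometric _ _ K (1 / 2)); [lra|lra|move=> k].
  by have := iter k s ltac:(lra); lra.
by rewrite exprS -mulrA; lra.
Qed.

Lemma no_isolated_zero (R : realType) (n p : nat) (U : set (Cspace R n))
    (X : Cspace R n -> Cspace R n) (a : 'I_p.+1 -> Cplx R) (m : Cspace R n) (r0 : R) :
  (0 < n)%N -> (forall k, a k != 0) -> injective a -> X m = 0 -> 0 < r0 ->
  (forall z, vmod (z - m) < r0 -> differentiable X z) ->
  (forall z, vmod (z - m) < r0 -> vmod (X z) <= 1) ->
  (forall z, vmod (z - m) < r0 -> exists phi : 'I_p.+1 -> Cplx R -> Cspace R n,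
     (forall k, is_flow_at U (fun x => a k *: X x) z (phi k)) /\
     \forall t \near (0 : Cplx R), \sum_(k < p.+1) a k *: X (phi k t) = 0) ->
  exists2 z, vmod (z - m) < r0 & z <> m /\ X z = 0.
Proof.
move=> n0 a0 aI Xm r00 dX0 bX0 chX0; apply: contrapT => noz.
have {}noz z : vmod (z - m) < r0 -> X z = 0 -> z = m.
  by move=> zr Xz; apply: contrapT => zm; apply: noz; exists z.
(* [lipschitz_ball] gives its bound on a quarter of the radius only. *)
pose r := r0 / 4; have rpos : 0 < r by rewrite divr_gt0.
have in0 z : vmod (z - m) < r -> vmod (z - m) < r0 by rewrite /r; lra.
pose L := 36 * 1 / r0; have Lpos : 0 < L by rewrite divr_gt0.
have lipX y z : vmod (y - m) < r -> vmod (z - m) < r ->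
    vmod (X z - X y) <= L * vmod (z - y).
  exact: lipschitz_ball.
have dX z : vmod (z - m) < r -> differentiable X z by move=> /in0 /dX0.
have bX z : vmod (z - m) < r -> vmod (X z) <= 1 by move=> /in0 /bX0.
pose eps := r / 2; have epspos : 0 < eps by rewrite divr_gt0.
have epsr : eps < r by rewrite /eps; lra.
have [C Cpos markov] := markov_bound R p.+1.
have [||c cpos cmin] := @sphere_min R n n X m eps n0 epspos.
- by move=> z zE; apply: dX; rewrite zE.
- move=> z zE Xz; have zm : z = m by apply: noz => //; apply: in0; rewrite zE.
  by move: zE epspos; rewrite zm subrr vmod0 => <-; rewrite ltxx.
(* [J] periods of length 1 / (2 L) cover the bound C * eps / c on the exit time; [eta] is such that
   [J] doublings lead only to eps / 2. *)
pose J := (Num.truncn (C * eps / c * (2 * L))).+1.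
have JP : C * eps / c <= J%:R / (2 * L).
  rewrite ler_pdivlMr; last by rewrite mulr_gt0.
  have : C * eps / c * (2 * L) < J%:R by exact: truncnS_gt.
  by move=> /ltW.
pose eta := eps / 2 ^+ J.+1.
have etapos : 0 < eta by rewrite divr_gt0// exprn_gt0.
have etaE : 2 ^+ J * eta = eps / 2.
  by rewrite /eta exprS; field; rewrite expf_neq0.
pose x : Cspace R n := m + const_mx eta%:C%C.
have xE : vmod (x - m) = eta.
  rewrite /x addrAC subrr add0r; apply/eqP; rewrite eq_le; apply/andP; split.
    by apply/vmod_leP => [|i]; [exact: ltW|rewrite mxE cmod_real gtr0_norm].
  have := cmod_le_vmod (const_mx eta%:C%C : Cspace R n) (Ordinal n0).
  by rewrite mxE cmod_real gtr0_norm.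
have eta_eps : eta < eps.
  have : eta <= 2 ^+ J * eta by rewrite ler_peMl ?(ltW etapos)// exprn_ege1// ler1n.
  by rewrite etaE; lra.
have xr : vmod (x - m) < r by rewrite xE; lra.
have Xx0 : 0 < vmod (X x).
  rewrite lt_def vmod_ge0 andbT; apply/eqP => /vmod_eq0 /(noz x (in0 x xr)) xm.
  by move: xE etapos; rewrite xm subrr vmod0 => <-; rewrite ltxx.
have [P [delta [deltapos sP P0 Ploc]]] :=
  chambar_trajectory_poly a0 aI (ltW Lpos) dX bX lipX (fun z zr => chX0 z (in0 z zr)) xr.
have path0 : poly_path P 0 = x by apply/rowP => i; rewrite mxE P0.
pose f (s : R) := vmod (poly_path P s%:C%C - m).
have bound_ge0 (T : R) : 0 < T -> 0 <= C * eps / T.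
  by move=> Tpos; apply: divr_ge0; [apply: mulr_ge0; exact: ltW|exact: ltW].
have speed T : 0 < T -> (forall s, 0 <= s <= T -> f s <= eps) ->
    forall s i, 0 <= s <= T -> cmod (P i)^`().[s%:C%C] <= C * eps / T.
  move=> Tpos fT s i sT; pose D := P i - (m ord0 i)%:P.
  have -> : (P i)^`() = D^`() by rewrite /D derivB derivC subr0.
  apply: markov sT => //.
    apply: leq_trans (size_polyD _ _) _; rewrite geq_max sP size_polyN.
    by apply: leq_trans (size_polyC_leq1 _) _.
  move=> u uT; rewrite /D hornerD hornerN hornerC.
  have := cmod_le_vmod (poly_path P u%:C%C - m) i; rewrite !mxE => /le_trans; apply.
  exact: fT.
have [t0 t00 ft0] : exists2 t0, 0 <= t0 & eps <= f t0.
  apply: contrapT => h.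
  have fle s : 0 <= s -> f s <= eps.
    by move=> s0; rewrite leNgt; apply/negP => fs; apply: h; exists s => //; exact: ltW.
  (* If the path never left the ball, its speed at time 0 would be at most C * eps / T for every
     [T]; this [T] makes the bound half of |X x|. Only time 0 is used, where the equation is known
     to hold. *)
  pose T := 2 * (C * eps) / vmod (X x).
  have Tpos : 0 < T by rewrite divr_gt0// !mulr_gt0.
  have : vmod (X x) <= C * eps / T.
    apply/vmod_leP => [|i]; first by exact: bound_ge0.
    have [|_ /(_ i)] := Ploc 0; first by rewrite cmod0.
    rewrite -[\row_i _]/(poly_path P 0) path0 => ->.
    rewrite -(rmorph0 (real_complex R)); apply: speed => //.
      by move=> s /andP[s0 _]; exact: fle.
    by rewrite lexx (ltW Tpos).
  have -> : C * eps / T = vmod (X x) / 2.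
    by rewrite /T; field; rewrite !gt_eqF.
  by lra.
have [||T [Tpos fT fle]] := @first_hit R f t0 eps t00 _ _ ft0.
- move=> s _ e e0.
  have [q q0 qP] := differentiable_curve_continuous (differentiable_poly_path P s%:C%C) e0.
  exists q => // t tq; apply: le_lt_trans (vmod_dist_dist _ _) _.
  have -> : poly_path P t%:C%C - m - (poly_path P s%:C%C - m) =
    poly_path P t%:C%C - poly_path P s%:C%C by rewrite opprB addrA subrK.
  by apply: qP; rewrite -rmorphB cmod_real.
- by rewrite /f rmorph0 path0 xE.
have T0 : 0 <= T <= T by rewrite lexx (ltW Tpos).
have inr s : 0 <= s <= T -> vmod (poly_path P s%:C%C - m) < r.
  by move=> /fle; rewrite /f; lra.
have ext := poly_trajectory_extends deltapos (ltW Tpos) dX bX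
  (fun t td => (Ploc t td).2) inr.
(* At the exit point the speed is |X|, by [ext]: at least [c] on the sphere, at most C * eps / T by
   Markov. *)
have Tle : T <= C * eps / c.
  rewrite ler_pdivlMr// mulrC -ler_pdivlMr//; apply: le_trans (cmin _ fT) _.
  apply/vmod_leP => [|i]; first by exact: bound_ge0.
  by rewrite ext//; apply: speed.
have growth : f T <= 2 ^+ J * vmod (poly_path P 0 - m).
  apply: (@poly_path_growth R n m P L T eps) => //.
    move=> s sT i; rewrite -ext//.
    have := lipX m _ _ (inr s sT); rewrite Xm subr0 subrr vmod0 => /(_ rpos).
    exact: le_trans (cmod_le_vmod _ _).
  exact: le_trans Tle JP.
by move: growth; rewrite path0 xE etaE fT; lra.
Qed.

Unset Implicit Arguments.

Theorem theorem3 (R : realType) (n p : nat) (U : set (Cspace R n))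
    (X : Cspace R n -> Cspace R n) (a : 'I_p -> Cplx R)
    (openU : open U) (connectedU : connected U)
    (holX : holomorphic_on U X)
    (chambarX : is_chambar U (fun k x => a k *: X x))
    (singX : exists m, Sing U X m) :
  (1 <= analytic_dim (Sing U X))%E.
Proof.
case: singX => m [Um Xm].
apply: (@le_trans _ _ (analytic_dim_at (Sing U X) m)); last first.
  by apply: ereal_sup_ubound; exists m.
(* For d = 0 there are no equations to satisfy, so [isolating] says that [m] is isolated in
   [Sing U X]. *)
apply/ereal_infP => _ [[|d] isod <-]; last by rewrite lee_fin ler1n.
exfalso; case: isod => f [_ _ /near_vmodP[r1 r10 r1P]].
have [r2 r20 r2P] : exists2 r : R, 0 < r & forall y, vmod (y - m) < r -> U y.
  by apply/near_vmodP; exact: open_nbhs_nbhs.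
have [r3 r30 r3P] := differentiable_vmod_continuous (holX m Um) ltr01.
pose r0 := Num.min r1 (Num.min r2 r3).
have r00 : 0 < r0 by rewrite !lt_min r10 r20.
have ball z : vmod (z - m) < r0 -> [/\ U z, vmod (X z) <= 1 & X z = 0 -> z = m].
  rewrite !lt_min => /and3P[z1 z2 z3]; split.
  - exact: r2P.
  - by have := r3P z z3; rewrite Xm subr0 => /ltW.
  - by move=> Xz; apply: r1P => //; [split=> //; exact: r2P|case].
case: p a chambarX => [|p] a [p0 _ nz distinct flows]; first by [].
(* In dimension 0 every vector is 0, but the fields of a chambar are not identically zero. *)
have n0 : (0 < n)%N.
  case: n U X openU connectedU holX m Um Xm a nz {p0 distinct flows f r1 r10 r1P
    r2 r20 r2P r3 r30 r3P r0 r00 ball} => [|//] U X _ _ _ m _ _ a nz.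
  by have [x _ []] := nz ord0; apply/rowP => -[].
have a0 k : a k != 0.
  by apply/eqP => ak; have [x _ []] := nz k; rewrite ak scale0r.
have aI : injective a.
  move=> j k ajk; apply/eqP; apply: contraT => /distinct [x _ []].
  by rewrite ajk.
have [z zr [zm Xz]] : exists2 z, vmod (z - m) < r0 & z <> m /\ X z = 0.
  apply: (@no_isolated_zero R n p U X a) => //.
  - by move=> z /ball [Uz _ _]; exact: holX.
  - by move=> z /ball [].
  - by move=> z /ball [Uz _ _]; exact: flows.
by apply: zm; case: (ball z zr) => _ _; exact.
Qed.
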